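(* Let $r\ge 2$ be an integer and let $G$ be a graph on $n$ vertices with $\lambda(G)\ge \lambda(T_r(n))$. Then either $G\cong T_r(n)$, or there is a vertex $v$ of $G$ such that \[ \lambda\bigl(G[N(v)]\bigr) > \lambda\bigl(T_{r-1}(d(v))\bigr). \] Furthermore, if $\lambda(G)>\lambda(T_r(n))$, then this conclusion holds for every vertex $v$ attaining the maximum entry in any nonnegative eigenvector of the adjacency matrix of $G$ corresponding to the eigenvalue $\lambda(G)$.
   Context: All graphs are finite and simple. $\lambda(G)$ denotes the spectral radius (largest eigenvalue) of the adjacency matrix of $G$. $T_r(n)$ is the $r$-partite Turán graph: the complete $r$-partite graph on $n$ vertices whose part sizes differ by at most one. $N(v)$ is the neighborhood of $v$, $d(v)=|N(v)|$ its degree, and $G[X]$ the subgraph induced by $X$ (the graph with no vertices, and the edgeless graph, have spectral radius $0$). *)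

(* Defs.v *)
From HB Require Import structures.
From mathcomp Require Import all_boot all_order all_algebra all_fingroup.
From mathcomp Require Import polyrcf.
From mathcomp Require Import reals.
Set Implicit Arguments. Unset Strict Implicit. Unset Printing Implicit Defensive.
Import Order.TTheory GRing.Theory Num.Theory.
Local Open Scope ring_scope.

Definition simple_graph (V : finType) (g : rel V) : Prop :=
  symmetric g /\ irreflexive g.

(* Spectral radius of a square real matrix: the largest real root of its
   characteristic polynomial (for symmetric matrices all eigenvalues are real),
   with the convention that it is 0 when there is no eigenvalue (0x0 matrix).
   For an adjacency matrix the largest eigenvalue is >= 0 (trace 0), so taking
   the max together with 0 does not change the value in the nonempty case. *)
Definition spec_rad (R : realType) (m : nat) (A : 'M[R]_m) : R :=
  \big[Num.max/0]_(x <- rootsR (char_poly A)) x.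

Definition adj_induced (R : realType) (V : finType) (g : rel V) (S : {set V})
  : 'M[R]_#|S| :=
  \matrix_(i, j) (g (enum_val i) (enum_val j))%:R.

Definition lambda_ind (R : realType) (V : finType) (g : rel V) (S : {set V}) : R :=
  spec_rad (adj_induced R g S).

Definition adj (R : realType) (n : nat) (g : rel 'I_n) : 'M[R]_n :=
  \matrix_(i, j) (g i j)%:R.

Definition lambda (R : realType) (n : nat) (g : rel 'I_n) : R := spec_rad (adj R g).

(* Turan graph T_r(n) on vertices 'I_n: the parts are the residue classes
   mod r, whose sizes differ by at most one; two vertices are adjacent iff
   they lie in different parts. *)
Definition turan (r n : nat) : rel 'I_n :=
  fun i j => (i %% r != j %% r)%N.

Definition nbhd (V : finType) (g : rel V) (v : V) : {set V} := [set u | g v u].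
Definition deg (V : finType) (g : rel V) (v : V) : nat := #|nbhd g v|.

Definition isomorphic (n : nat) (g h : rel 'I_n) : Prop :=
  exists f : {perm 'I_n}, forall x y, g x y = h (f x) (f y).
Arguments turan : clear implicits.

(* Main.v *)
(* Let x be a nonnegative eigenvector for lambda = lambda(G), with maximum 1 at
   v, let S = N(v), d = |S|, k = n - d and q = floor(n / r), and assume
   lambda(G[S]) <= mu := lambda(T_(r-1)(d)).  Since lambda = sum_S x <= d we get
   k <= q.  If k < q, the Rayleigh quotient of G[S] at x and Cauchy-Schwarz give
   lambda (lambda - mu) <= k d, which is below what lambda >= lambda(T_r(n))
   allows.  If k = q, put w = 1 - x on S; then sum_S w = d - lambda <= 1, and
   1 - c w, with the constant c for which this is the Perron vector in the
   extremal case, is a test vector on S.  Subtracting mu from its Rayleigh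
   quotient leaves a sum of nonnegative terms: the surplus of lambda, the missing
   weight outside S, a degree term that is nonnegative because degrees are
   integers, and the sum of (w u - w y)^2 over nonadjacent u, y.  Hence
   lambda = lambda(T_r(n)) and all terms vanish.  This makes every vertex of
   weight 1 lie in an independent part of size q completely joined to the rest,
   and leaves a set of j(q+1) lighter vertices (j = n mod r) with q + 1
   non-neighbours each; the assumption at those lighter vertices forces
   non-adjacency to be transitive there as well. *)
Require Import Defs.
From HB Require Import structures.
From mathcomp Require Import all_boot all_order all_algebra all_fingroup.
From mathcomp Require Import polyrcf ring lra zify.
From mathcomp Require Import classical_sets reals topology normedtype derive.
Set Implicit Arguments. Unset Strict Implicit. Unset Printing Implicit Defensive.
Import Order.TTheory GRing.Theory Num.Theory.
Import numFieldNormedType.Exports.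
Local Open Scope ring_scope.

(** * Rayleigh quotients and Perron vectors *)

Definition qform (R : realType) m (A : 'M[R]_m) (y : 'rV[R]_m) : R :=
  \sum_i \sum_j A i j * y ord0 i * y ord0 j.

Lemma qformE (R : realType) m (A : 'M[R]_m) (y : 'rV[R]_m) :
  qform A y = (y *m A *m y^T) ord0 ord0.
Proof.
rewrite mxE /qform exchange_big /=; apply: eq_bigr => j _.
rewrite !mxE mulr_suml; apply: eq_bigr => i _; ring.
Qed.

Definition sqnorm (R : realType) m (y : 'rV[R]_m) : R := \sum_i y ord0 i ^+ 2.

Lemma sqnormE (R : realType) m (y : 'rV[R]_m) :
  sqnorm y = (y *m y^T) ord0 ord0.
Proof. by rewrite mxE; apply: eq_bigr => i _; rewrite mxE expr2. Qed.

Lemma sqnorm_ge0 (R : realType) m (y : 'rV[R]_m) : 0 <= sqnorm y.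
Proof. by apply: sumr_ge0 => i _; rewrite sqr_ge0. Qed.

Lemma sqnorm_eq0 (R : realType) m (y : 'rV[R]_m) : (sqnorm y == 0) = (y == 0).
Proof.
apply/idP/eqP => [|->]; last first.
  by rewrite /sqnorm big1 // => i _; rewrite mxE expr0n.
rewrite psumr_eq0 => [/allP h|i _]; last exact: sqr_ge0.
apply/rowP => i; rewrite mxE.
by have := h i (mem_index_enum i); rewrite /= sqrf_eq0 => /eqP.
Qed.

Lemma sqnormZ (R : realType) m (a : R) (y : 'rV[R]_m) :
  sqnorm (a *: y) = a ^+ 2 * sqnorm y.
Proof.
by rewrite /sqnorm mulr_sumr; apply: eq_bigr => i _; rewrite mxE exprMn.
Qed.

Lemma qformZ (R : realType) m (A : 'M[R]_m) (a : R) (y : 'rV[R]_m) :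
  qform A (a *: y) = a ^+ 2 * qform A y.
Proof.
rewrite /qform mulr_sumr; apply: eq_bigr => i _.
by rewrite mulr_sumr; apply: eq_bigr => j _; rewrite !mxE; ring.
Qed.

(* Minimising [t |-> q(c + t y)] at [t = 0] kills the polar form of [q] at [c]. *)
Lemma psd_null (R : realType) m (B : 'M[R]_m) (c : 'rV[R]_m) :
  B^T = B -> (forall y, 0 <= qform B y) -> qform B c = 0 -> c *m B = 0.
Proof.
move=> Bs Bpsd Bc; set y := c *m B.
have pol t : qform B (c + t *: y) = 2 * t * sqnorm y + t ^+ 2 * qform B y.
  have e : (y *m B *m c^T) ord0 ord0 = sqnorm y.
    rewrite sqnormE -[y *m B *m c^T]trmxK mxE.
    by rewrite !trmx_mul Bs trmxK mulmxA.
  rewrite !qformE in Bc *; rewrite linearD linearZ /= !mulmxDl !mulmxDr.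
  rewrite -!scalemxAl -!scalemxAr -/y.
  rewrite ![(_ + _ : 'M__) _ _]mxE ![(_ *: _ : 'M__) _ _]mxE e -sqnormE.
  by move: Bc; rewrite -/y => ->; ring.
have [/eqP|ny0] := eqVneq (sqnorm y) 0; first by rewrite sqnorm_eq0 => /eqP.
have y0 : 0 < sqnorm y by rewrite lt0r ny0 sqnorm_ge0.
have q0 := Bpsd y; set s := sqnorm y in y0 pol *; set q := qform B y in q0 pol.
(* The exact minimiser would be [t = - s / q], but [q] may vanish. Taking [s + q] as denominator
   keeps it positive and still makes the value negative. *)
have := Bpsd (c + (- (s / (s + q))) *: y); rewrite pol => h.
have sq : 0 < s + q by apply: ltr_wpDr.
suff : 2 * - (s / (s + q)) * s + (- (s / (s + q))) ^+ 2 * q < 0.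
  by rewrite ltNge h.
have -> : 2 * - (s / (s + q)) * s + (- (s / (s + q))) ^+ 2 * q
   = - ((s / (s + q)) ^+ 2 * (2 * s + q)).
  by field; rewrite gt_eqF.
rewrite oppr_lt0 mulr_gt0 //; first by rewrite exprn_gt0 // divr_gt0.
by rewrite ltr_pwDl // mulr_gt0.
Qed.

Lemma sqnorm_normr (R : realType) m (y : 'rV[R]_m) :
  sqnorm (map_mx Num.norm y) = sqnorm y.
Proof. by apply: eq_bigr => i _; rewrite mxE real_normK ?num_real. Qed.

Lemma qform_normr (R : realType) m (A : 'M[R]_m) (y : 'rV[R]_m) :
  (forall i j, 0 <= A i j) -> qform A y <= qform A (map_mx Num.norm y).
Proof.
move=> A0; apply: ler_sum => i _; apply: ler_sum => j _.
by rewrite !mxE -!mulrA ler_wpM2l // -normrM ler_norm.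
Qed.

Lemma qform_scalarB (R : realType) m (A : 'M[R]_m) (a : R) (y : 'rV[R]_m) :
  qform (a%:M - A) y = a * sqnorm y - qform A y.
Proof.
rewrite !qformE sqnormE mulmxBr mul_mx_scalar mulmxBl -scalemxAl.
by rewrite !mxE.
Qed.

(** The form attains a maximum [a] on the compact unit sphere. By homogeneity [a%:M - A] is positive
    semidefinite, and it vanishes at the maximiser, which is therefore an eigenvector by
    [psd_null]. *)
Lemma rayleigh_max (R : realType) m (A : 'M[R]_m.+1) : A^T = A ->
  exists (a : R) (v : 'rV[R]_m.+1),
    [/\ v != 0, v *m A = a *: v & forall y, qform A y <= a * sqnorm y].
Proof.
move=> As.
have cont (f : 'I_m.+1 -> 'rV[R]_m.+1 -> R) :
    (forall i, continuous (f i)) -> continuous (fun y => \sum_i f i y).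
  move=> cf; apply: continuous_big => [|i _]; first exact: add_continuous.
  exact: cf.
have cC i : continuous (fun y : 'rV[R]_m.+1 => y ord0 i).
  exact: coord_continuous.
have cM (f h : 'rV[R]_m.+1 -> R) :
    continuous f -> continuous h -> continuous (fun y => f y * h y).
  by move=> cf ch y; exact: (@continuousM R _ f h y (cf y) (ch y)).
have cq : continuous (qform A).
  apply: (cont) => i; apply: (cont) => j.
  apply: (cM (fun y => A i j * y ord0 i)); last exact: cC.
  by apply: (cM (fun=> A i j)); [exact: cst_continuous | exact: cC].
have cs : continuous (@sqnorm R m.+1).
  by apply: (cont) => i; apply: (cM (fun y => y ord0 i)); exact: cC.
pose S : set 'rV[R]_m.+1 := [set y | sqnorm y = 1]%classic.
have Scl : closed S.
  by apply: (@preimage_closed _ _ (@sqnorm R m.+1) [set 1]%classic) => //.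
have Sbd : bounded_set S.
  exists 1; split=> [|M M1 y Sy]; first exact: num_real.
  rewrite /Num.Def.normr /= mx_normrE; apply/bigmax_leP; split; first lra.
  move=> [i j] _ /=; rewrite ord1.
  have: `|y ord0 j| ^+ 2 <= 1.
    rewrite real_normK ?num_real // -[leRHS]Sy /sqnorm (bigD1 j) //= lerDl.
    by apply: sumr_ge0 => k _; exact: sqr_ge0.
  by rewrite -[leRHS](expr1n _ 2) ler_pXn2r ?nnegrE //; lra.
have S0 : (S !=set0)%classic.
  exists (delta_mx ord0 ord0); rewrite /S /= /sqnorm (bigD1 ord0) //= mxE !eqxx.
  rewrite expr1n big1 ?addr0 // => i /negPf i0; rewrite mxE i0 andbF.
  by rewrite expr0n.
have [c cS cmax] := EVT_max_rV S0 (bounded_closed_compact Sbd Scl)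
  (continuous_subspaceT cq).
rewrite inE in cS; pose a := qform A c.
have amax y : qform A y <= a * sqnorm y.
  have [->|y0] := eqVneq y 0.
    rewrite -[0]/(0 : 'rV_m.+1) -(scale0r 0) qformZ sqnormZ expr0n !mul0r.
    by rewrite mulr0.
  have sy : 0 < sqnorm y by rewrite lt0r sqnorm_eq0 y0 sqnorm_ge0.
  have := cmax ((Num.sqrt (sqnorm y))^-1 *: y).
  rewrite inE /S /= sqnormZ qformZ exprVn (sqr_sqrtr (ltW sy)) mulVf ?gt_eqF //.
  by rewrite ler_pdivrMl // mulrC -/a; apply.
exists a, c; split=> //.
  by rewrite -sqnorm_eq0 cS oner_neq0.
have : c *m (a%:M - A) = 0.
  apply: psd_null => [|y|].
  - by rewrite linearB /= tr_scalar_mx As.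
  - by rewrite qform_scalarB subr_ge0.
  - by rewrite qform_scalarB cS mulr1 subrr.
by rewrite mulmxBr mul_mx_scalar => /eqP; rewrite subr_eq0 => /eqP.
Qed.

Lemma spec_rad_ge (R : realType) m (A : 'M[R]_m) (a : R) (v : 'rV[R]_m) :
  v != 0 -> v *m A = a *: v -> a <= spec_rad A.
Proof.
move=> v0 vA; apply: le_bigmax_seq => //.
have := roots_on_rootsR (monic_neq0 (char_poly_monic A)).
move=> /(_ a) <-; rewrite in_itv /= -eigenvalue_root_char.
by apply/eigenvalueP; exists v.
Qed.

Lemma spec_rad_le (R : realType) m (A : 'M[R]_m) (b : R) : 0 <= b ->
  (forall a (v : 'rV[R]_m), v != 0 -> v *m A = a *: v -> a <= b) ->
  spec_rad A <= b.
Proof.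
move=> b0 h; rewrite /spec_rad big_seq; apply: bigmax_le => // a.
have := roots_on_rootsR (monic_neq0 (char_poly_monic A)).
move=> /(_ a) <-; rewrite in_itv /= -eigenvalue_root_char.
by move=> /eigenvalueP [v vA v0]; exact: h vA.
Qed.

Lemma spec_rad_ge0 (R : realType) m (A : 'M[R]_m) : 0 <= spec_rad A.
Proof. by rewrite /spec_rad; apply: bigmax_ge_id. Qed.

Lemma spec_rad_rayleigh (R : realType) m (A : 'M[R]_m) : A^T = A ->
  forall y, qform A y <= spec_rad A * sqnorm y.
Proof.
case: m A => [|m] A As y; first by rewrite /qform /sqnorm !big_ord0 mulr0.
have [a [v [v0 vA h]]] := rayleigh_max As.
apply: le_trans (h y) _; rewrite ler_wpM2r ?sqnorm_ge0 //.
exact: spec_rad_ge vA.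
Qed.

Lemma qform_eigen (R : realType) m (A : 'M[R]_m) (a : R) (v : 'rV[R]_m) :
  v *m A = a *: v -> qform A v = a * sqnorm v.
Proof. by move=> vA; rewrite qformE vA -scalemxAl mxE sqnormE. Qed.

(** Taking absolute values keeps the norm and, as the entries are nonnegative, does not lower the
    form. So the absolute value of a maximiser is again a maximiser, hence an eigenvector. *)
Lemma spec_rad_perron (R : realType) m (A : 'M[R]_m.+1) : A^T = A ->
  (forall i j, 0 <= A i j) ->
  exists v : 'rV[R]_m.+1,
    [/\ v != 0, forall i, 0 <= v ord0 i & v *m A = spec_rad A *: v].
Proof.
move=> As A0; have [a [v [v0 vA h]]] := rayleigh_max As.
pose w := map_mx Num.norm v; have qw : qform A w = a * sqnorm w.
  apply/le_anti; rewrite h /= sqnorm_normr -(qform_eigen vA).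
  exact: qform_normr.
have w0 : w != 0 by rewrite -sqnorm_eq0 sqnorm_normr sqnorm_eq0.
have wA : w *m A = a *: w.
  have : w *m (a%:M - A) = 0.
    apply: psd_null => [|y|].
    - by rewrite linearB /= tr_scalar_mx As.
    - by rewrite qform_scalarB subr_ge0.
    - by rewrite qform_scalarB qw subrr.
  by rewrite mulmxBr mul_mx_scalar => /eqP; rewrite subr_eq0 => /eqP.
(* As [spec_rad] is a maximum taken together with [0], the upper bound also needs [0 <= a]; it
   follows from the nonnegative entries through [qw]. *)
have aE : spec_rad A = a.
  apply/le_anti; rewrite (spec_rad_ge w0 wA) andbT; apply: spec_rad_le.
    have : 0 <= a * sqnorm w.
      rewrite -qw; apply: sumr_ge0 => i _; apply: sumr_ge0 => j _.
      by rewrite !mxE !mulr_ge0.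
    by rewrite pmulr_lge0 // lt0r sqnorm_eq0 w0 sqnorm_ge0.
  move=> b u u0 uA; have := h u; rewrite (qform_eigen uA) ler_pM2r //.
  by rewrite lt0r sqnorm_eq0 u0 sqnorm_ge0.
by exists w; split=> // [i|]; [rewrite mxE | rewrite aE].
Qed.

(* Pair an arbitrary eigenvector, taken in absolute value, with [z]. *)
Lemma spec_rad_pos_eigen (R : realType) m (A : 'M[R]_m) (a : R)
    (z : 'I_m -> R) :
  A^T = A -> (forall i j, 0 <= A i j) -> 0 <= a -> (forall i, 0 < z i) ->
  (forall i, \sum_j A i j * z j = a * z i) -> (0 < m)%N -> spec_rad A = a.
Proof.
move=> As A0 a0 z0 zA m0; apply/le_anti/andP; split; last first.
  apply: (@spec_rad_ge _ _ _ _ (\row_i z i)).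
    apply/eqP => /rowP /(_ (Ordinal m0)); rewrite !mxE => /eqP.
    by rewrite gt_eqF.
  apply/rowP => i; rewrite !mxE -zA; apply: eq_bigr => j _.
  by rewrite mxE mulrC -[in LHS]As mxE.
apply: spec_rad_le => // b v v0 vA.
pose W := \sum_i `|v ord0 i| * z i.
have W0 : 0 < W.
  have [i vi] : exists i, v ord0 i != 0.
    apply/existsP; apply: contraNT v0; rewrite negb_exists => /forallP h.
    apply/eqP/rowP => i; rewrite mxE; apply/eqP.
    by have := h i; rewrite negbK.
  rewrite /W (bigD1 i) //=; apply: ltr_pwDl.
    by rewrite mulr_gt0 // normr_gt0.
  by apply: sumr_ge0 => j _; rewrite mulr_ge0 // ltW.
have [b0|b0] := lerP b 0; first exact: le_trans b0 a0.
(* It remains to show [b * W <= a * W]: the triangle inequality in each coordinate of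
   [v *m A = b *: v], weighted by [z] and summed. *)
rewrite -(ler_pM2r W0) /W !mulr_sumr.
have e : \sum_i a * (`|v ord0 i| * z i)
    = \sum_j (\sum_i `|v ord0 i| * A i j) * z j.
  transitivity (\sum_i \sum_j `|v ord0 i| * A i j * z j).
    apply: eq_bigr => i _; rewrite mulrCA -zA mulr_sumr.
    by apply: eq_bigr => j _; rewrite mulrA.
  by rewrite exchange_big /=; apply: eq_bigr => j _; rewrite mulr_suml.
rewrite e; apply: ler_sum => j _; rewrite mulrA (ler_wpM2r (ltW (z0 j))) //.
have -> : b * `|v ord0 j| = `|\sum_i v ord0 i * A i j|.
  by move/rowP: vA => /(_ j); rewrite !mxE => ->; rewrite normrM gtr0_norm.
apply: le_trans (ler_norm_sum _ _ _) _; apply: ler_sum => i _.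
by rewrite normrM (ger0_norm (A0 i j)).
Qed.

Lemma lambda_ind_rayleigh (R : realType) (V : finType) (g : rel V)
    (S : {set V}) (z : V -> R) : symmetric g ->
  \sum_(u in S) \sum_(w in S) (g u w)%:R * z u * z w
    <= lambda_ind R g S * \sum_(u in S) z u ^+ 2.
Proof.
move=> gs; have As : (adj_induced R g S)^T = adj_induced R g S.
  by apply/matrixP => i j; rewrite !mxE gs.
have := spec_rad_rayleigh As (\row_i z (enum_val i)).
rewrite /qform /sqnorm; congr (_ <= _ * _); rewrite [RHS]big_enum_val /=.
  apply: eq_bigr => i _; rewrite [RHS]big_enum_val /=.
  by apply: eq_bigr => j _; rewrite !mxE.
by apply: eq_bigr => i _; rewrite mxE.
Qed.

Lemma lambda_perron (R : realType) n (g : rel 'I_n) : (0 < n)%N ->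
  symmetric g ->
  exists x : 'cV[R]_n, [/\ x != 0, forall i, 0 <= x i ord0
    & adj R g *m x = lambda R g *: x].
Proof.
case: n g => // n g _ gs.
have As : (adj R g)^T = adj R g by apply/matrixP => i j; rewrite !mxE gs.
have [|v [v0 vp vA]] := spec_rad_perron As.
  by move=> i j; rewrite mxE ler0n.
exists v^T; split=> [|i|].
- by rewrite -(trmx0 R 1 n.+1) (inj_eq (@trmx_inj _ _ _)).
- by rewrite mxE.
- by rewrite -{1}As -trmx_mul vA linearZ.
Qed.

(** * The spectral radius of Turan graphs *)

(** The part sizes of the Turan graph. By induction on [n]: the quotient grows exactly when [r]
    divides [n.+1]. *)
Lemma sum_modn_eq r n c : (c < r)%N ->
  (\sum_(m < n) (m %% r == c) = n %/ r + (c < n %% r))%N.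
Proof.
move=> cr; have r0 : (0 < r)%N by apply: leq_ltn_trans cr.
elim: n => [|n IH]; first by rewrite big_ord0 div0n mod0n.
rewrite big_ord_recr /= IH divnS // modnS.
have := ltn_pmod n r0; have := divn_eq n r.
case: ifP => h.
  have -> : (n %% r = r.-1)%N.
    move: h; rewrite /dvdn -addn1 -modnDml addn1 => /eqP h.
    have [/modn_small e|] := ltnP (n %% r).+1 r; first by rewrite e in h.
    have := ltn_pmod n r0; lia.
  by move=> _ _; lia.
by move=> _ _; lia.
Qed.

Lemma sum_modn_lt r n : (0 < r)%N ->
  (\sum_(m < n) (m %% r < n %% r) = n %% r * (n %/ r).+1)%N.
Proof.
move=> r0; have jr := ltn_pmod n r0.
transitivity (\sum_(m < n) \sum_(c < n %% r) (m %% r == c :> nat))%N.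
  apply: eq_bigr => m _; have [h|h] := ltnP (m %% r) (n %% r).
    rewrite (bigD1 (Ordinal h)) //= eqxx big1 // => c /eqP hc.
    by case: eqP => // e; case: hc; apply: val_inj; rewrite /= e.
  by rewrite big1 // => c _; case: eqP => // e; have := ltn_ord c; lia.
rewrite exchange_big /=.
rewrite (eq_bigr (fun=> (n %/ r).+1)); last first.
  move=> c _; rewrite sum_modn_eq; last exact: ltn_trans jr.
  by rewrite ltn_ord addn1.
by rewrite sum_nat_const card_ord.
Qed.

Lemma turan_tr (R : realType) r n : (adj R (turan r n))^T = adj R (turan r n).
Proof. by apply/matrixP => i j; rewrite !mxE /turan eq_sym. Qed.

(* With [q = n %/ r] and [j = n %% r] the quotient matrix of the Turan graph
   has [(n - q - t)(t + q + 1) = j (q + 1)] as its characteristic equation;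
   [n - q - 1 <= t] singles out the largest root. *)
Lemma lambda_turan (R : realType) r n (L := lambda R (turan r n)) :
  (0 < r)%N ->
  (n%:R - (n %/ r)%:R - L) * (L + (n %/ r)%:R + 1)
    = (n %% r)%:R * ((n %/ r)%:R + 1) /\
  n%:R - (n %/ r)%:R - 1 <= L.
Proof.
move=> r0; have nE := divn_eq n r; have jr := ltn_pmod n r0.
have [n0|n0] := posnP n.
  have -> : L = 0.
    apply/le_anti; rewrite spec_rad_ge0 andbT; apply: spec_rad_le => // a v.
    by case/eqP; apply/rowP => -[m mn]; exfalso; rewrite n0 in mn.
  by rewrite n0 div0n mod0n; split; [ring | lra].
set q := (n %/ r)%N in nE *; set j := (n %% r)%N in nE jr *.
have A0 i k : 0 <= adj R (turan r n) i k by rewrite mxE ler0n.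
have [q0|q0] := posnP q.
  have nr : (n < r)%N by rewrite nE q0 mul0n.
  have -> : L = n%:R - 1.
    apply: (@spec_rad_pos_eigen _ _ _ _ (fun=> 1)) => //.
    - exact: turan_tr.
    - by rewrite subr_ge0 ler1n.
    - move=> i; under eq_bigr => k _ do
        rewrite mxE mulr1 /turan !modn_small ?(ltn_trans (ltn_ord _) nr) //.
      rewrite mulr1 -[in RHS](card_ord n) -sum1_card natr_sum (bigD1 i) //=.
      rewrite eqxx add0r [in RHS](bigD1 i) //= [1%:R + _]addrC addrK.
      apply: eq_bigr => k ki; rewrite (_ : _ != _) // eq_sym.
      by rewrite (inj_eq val_inj).
  have -> : j = n by rewrite nE q0 mul0n.
  by rewrite q0; split; [ring | lra].
(* Expanded, the characteristic equation is [t ^+ 2 - b * t - C = 0], with discriminant [D]; below,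
   [t] is its larger root. *)
pose b : R := n%:R - 2 * q%:R - 1.
pose C : R := (n%:R - q%:R - j%:R) * (q%:R + 1).
have nER : n%:R = q%:R * r%:R + j%:R :> R by rewrite -natrM -natrD -nE.
have q1 : 1 <= q%:R :> R by rewrite ler1n.
have jr1 : j%:R + 1 <= r%:R :> R by rewrite natr1 ler_nat.
have j0 : 0 <= j%:R :> R by [].
have nqj : 0 <= n%:R - q%:R - j%:R :> R.
  have : 0 <= q%:R * (r%:R - 1) :> R by rewrite mulr_ge0 // subr_ge0 ler1n.
  by rewrite nER; lra.
have C0 : 0 <= C by rewrite /C mulr_ge0 //; lra.
pose D := b ^+ 2 + 4 * C.
have D0 : 0 <= D by rewrite /D; nra.
have sD : Num.sqrt D ^+ 2 = D by rewrite sqr_sqrtr.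
have s0 : 0 <= Num.sqrt D by exact: sqrtr_ge0.
have sb : - b <= Num.sqrt D.
  rewrite -[- b]/(- b); apply: le_trans (ler_norm _) _.
  by rewrite -sqrtr_sqr ler_wsqrtr // /D; lra.
have n1 : 1 <= n%:R :> R by rewrite ler1n.
(* In terms of the root this is the bound [n - q - 1 <= t]. *)
have sn : n%:R - 1 <= Num.sqrt D.
  apply: le_trans (ler_norm _) _.
  rewrite -sqrtr_sqr ler_wsqrtr // /D /b /C.
  have : j%:R * (q%:R + 1) <= n%:R :> R by nra.
  by nra.
pose t := (b + Num.sqrt D) / 2.
have tE : (n%:R - q%:R - t) * (t + q%:R + 1) = j%:R * (q%:R + 1).
  rewrite /t; move: sD s0; set s := Num.sqrt D; rewrite /D /b /C => sD _.
  by field: sD.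
have t0 : 0 <= t by rewrite /t; lra.
have -> : L = t.
  (* Residues below [j] form the parts of size [q + 1], with weight [t + q]; the others have size
     [q] and weight [t + q + 1]. On every part the weight times [t] plus the part size is
     [(t + q) * (t + q + 1)], and by [tE] this is the total weight, so [z] is an eigenvector. *)
  pose z (i : 'I_n) : R := t + q%:R + (j <= i %% r)%:R.
  apply: (@spec_rad_pos_eigen _ _ _ _ z) => //.
  - exact: turan_tr.
  - by move=> i; rewrite /z; have := ler0n R (j <= i %% r); lra.
  - have Z : \sum_i z i = (t + q%:R) * (t + q%:R + 1).
      rewrite /z big_split /= sumr_const card_ord.
      have : (\sum_(i < n) (j <= i %% r))%:R = n%:R - j%:R * (q%:R + 1) :> R.
        rewrite natr1 -natrM -sum_modn_lt // -/j !natr_sum.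
        apply/eqP; rewrite -subr_eq0 opprB addrA -big_split /= subr_eq0.
        apply/eqP; rewrite -[in RHS](card_ord n) -sum1_card natr_sum.
        by apply: eq_bigr => i _; rewrite (leqNgt j); case: (_ < _)%N => /=; lra.
      rewrite natr_sum => ->; rewrite -[_ *+ n]mulr_natl -tE; ring.
    move=> i; transitivity (\sum_k z k - \sum_(k < n) (k %% r == i %% r)%N%:R * z i).
      rewrite -sumrB; apply: eq_bigr => k _; rewrite mxE /turan eq_sym /z.
      by case: eqP => [->|_]; rewrite ?mul0r ?mul1r; ring.
    rewrite -mulr_suml Z -natr_sum sum_modn_eq ?ltn_pmod // -/q -/j.
    rewrite /z natrD (leqNgt j); case: (_ < _)%N => /=; ring.
by split=> //; rewrite /t /b; lra.
Qed.

(** * Comparing characteristic equations *)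

(* Chord comparison: [t |-> t / (mu + t)] is concave, so replacing the true part
   sizes [l, l + 1] by the fictitious pair [q, q + 1] only weakens the
   characteristic equation of the Turan graph. *)
Lemma turan_char_le (R : realType) (s d q : nat) (mu : R) (l := (d %/ s)%N) :
  (0 < s)%N -> (q <= l)%N ->
  (d%:R - l%:R - mu) * (mu + l%:R + 1) = (d %% s)%:R * (l%:R + 1) ->
  d%:R - l%:R - 1 <= mu ->
  (d%:R - s%:R * q%:R) * (q%:R + 1) <= (d%:R - q%:R - mu) * (mu + q%:R + 1).
Proof.
move=> s0 ql E mul; have dE := divn_eq d s.
have dER : d%:R = l%:R * s%:R + (d %% s)%:R :> R by rewrite -natrM -natrD -dE.
move: ql; rewrite leq_eqVlt => /orP[/eqP->|ql].
  have -> : d%:R - s%:R * l%:R = (d %% s)%:R :> R by rewrite dER; ring.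
  by rewrite E.
have s1 : 1 <= s%:R :> R by rewrite ler1n.
have l0 : 0 <= l%:R :> R by [].
have qR : q%:R + 1 <= l%:R :> R by rewrite natr1 ler_nat.
have mu_ge : (s%:R - 1) * l%:R <= mu.
  have [j0|j0] := posnP (d %% s).
    move/eqP: E; rewrite j0 mul0r mulf_eq0 dER j0.
    move=> /orP[/eqP h|/eqP h]; first by lra.
    have q0 : 0 <= q%:R :> R by [].
    have : 0 <= l%:R * (s%:R - 1) :> R by rewrite mulr_ge0 // subr_ge0.
    by move: mul; rewrite dER j0; lra.
  have : 1 <= (d %% s)%:R :> R by rewrite ler1n.
  by move: mul; rewrite dER; lra.
(* By [E], this product is the right side of the goal minus its left side. *)
have h : 0 <= (l%:R - q%:R)
    * (2 * mu + 1 - s%:R - (s%:R - 1) * (l%:R + q%:R)).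
  apply: mulr_ge0; first lra.
  have : (s%:R - 1) * (q%:R + 1) <= (s%:R - 1) * l%:R :> R.
    by rewrite ler_wpM2l // subr_ge0.
  by lra.
have jE : (d %% s)%:R = d%:R - l%:R * s%:R :> R by rewrite dER; ring.
by rewrite jE in E; lra.
Qed.

(** The point is the boundary case [j = s], where all parts have size [q + 1] and the quotient is no
    longer [q]. There [mu = d - q - 1], which also solves the equation written with [q]. *)
Lemma turan_char_eq (R : realType) (s d q j : nat) (mu : R) (l := (d %/ s)%N) :
  (0 < s)%N -> d = (s * q + j)%N -> (j <= s)%N ->
  (d%:R - l%:R - mu) * (mu + l%:R + 1) = (d %% s)%:R * (l%:R + 1) ->
  d%:R - l%:R - 1 <= mu -> 0 <= mu ->
  (d%:R - q%:R - mu) * (mu + q%:R + 1) = j%:R * (q%:R + 1) /\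
  d%:R - q%:R - 1 <= mu.
Proof.
move=> s0 dE; rewrite leq_eqVlt => /orP[/eqP jE|js]; last first.
  have -> : l = q by rewrite /l dE mulnC divnMDl // divn_small // addn0.
  by have -> : (d %% s = j)%N by rewrite dE mulnC modnMDl modn_small.
have dE' : d = (q.+1 * s)%N by rewrite dE jE; ring.
have -> : l = q.+1 by rewrite /l dE' mulnK.
have -> : (d %% s = 0)%N by rewrite dE' modnMl.
rewrite mul0r -natr1 => /eqP; rewrite mulf_eq0 => /orP[/eqP h|/eqP h] m1 m0.
  have -> : mu = d%:R - q%:R - 1 by lra.
  rewrite jE dE' natrM -natr1; split; [ring | lra].
by have := ler0n R q; lra.
Qed.

(** Were the conclusion false, [mu] would be at least [L - k - g] with [g = k * (e + eps) / L]. At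
    that value the product on the right of the last hypothesis equals [(j + e) * (q + 1) + g * (e +
    1 - eps - g) - e * (e + 1)]. This is below [(j + e) * (q + 1)], the left side of the same
    hypothesis. *)
Lemma turan_gap (R : realType) (n q k r j L mu : R) :
  n = q * r + j -> 0 <= j -> 1 <= q -> 1 <= k -> k <= q - 1 ->
  (n - q - L) * (L + q + 1) = j * (q + 1) -> n - q - 1 <= L -> q <= L ->
  (n - k - (r - 1) * q) * (q + 1) <= (n - k - q - mu) * (mu + q + 1) ->
  k * (n - k) < L * (L - mu).
Proof.
move=> nE j0 q1 k1 kq EL Ll qL Emu; rewrite ltNge; apply/negP => bad.
pose e := q - k; pose eps := n - q - L.
have eps0 : 0 <= eps.
  have : 0 <= eps * (L + q + 1) by rewrite EL mulr_ge0 //; lra.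
  by rewrite pmulr_lge0 //; lra.
have eps1 : eps <= 1 by rewrite /eps; lra.
have e1 : 1 <= e by rewrite /e; lra.
have L0 : 0 < L by lra.
pose g := k * (e + eps) / L.
have gL : g * L = k * (e + eps) by rewrite /g divfK // gt_eqF.
have g0 : 0 <= g by rewrite /g divr_ge0 ?mulr_ge0 //; lra.
have mug : L - k - g <= mu.
  rewrite -(ler_pM2r L0); have -> : (L - k - g) * L = L * L - k * L - g * L by ring.
  by rewrite gL; move: bad; rewrite /e /eps; lra.
have g_le : 2 * g <= L + 1.
  rewrite -(ler_pM2r L0); have -> : 2 * g * L = 2 * (k * (e + eps)).
    by rewrite -mulrA gL.
  have : 0 <= (k - (e + eps)) ^+ 2 by exact: sqr_ge0.
  have kee : k + (e + eps) <= L + 1 by rewrite /e; lra.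
  have : (k + (e + eps)) ^+ 2 <= (L + 1) ^+ 2.
    by rewrite ler_pXn2r ?nnegrE //; lra.
  have : 0 <= (L + 1) * (L - 1) by rewrite mulr_ge0 //; lra.
  by lra.
(* As a function of [mu] the product is a concave parabola, and [g_le] places [L - k - g] beyond its
   vertex, so a larger [mu] only lowers it. *)
have F1 : (n - k - q - mu) * (mu + q + 1) <= (eps + g) * (L + e + 1 - g).
  have : 0 <= (mu - (L - k - g)) * (mu + (L - k - g) - (n - k - 2 * q - 1)).
    apply: mulr_ge0; first by rewrite subr_ge0.
    by move: g_le mug; rewrite /eps /e; lra.
  by rewrite /eps /e; lra.
have F2 : (eps + g) * (L + e + 1 - g)
    = (j + e) * (q + 1) + g * (e + 1 - eps - g) - e * (e + 1).
  have EL' : eps * (L + q + 1) = j * (q + 1) by [].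
  have kE : k = q - e by rewrite /e; ring.
  rewrite kE in gL; clearbody e eps g.
  by lra.
have F3 : (j + e) * (q + 1) = (n - k - (r - 1) * q) * (q + 1).
  by rewrite nE /e; ring.
(* By completing the square, four times the left side is at most [(e + 1 - eps) ^+ 2], hence at most
   [(e + 1) ^+ 2], which is below [4 * e * (e + 1)] as [1 <= e]. *)
have F4 : g * (e + 1 - eps - g) < e * (e + 1).
  have : 0 <= (2 * g - (e + 1 - eps)) ^+ 2 by exact: sqr_ge0.
  have : (e + 1 - eps) ^+ 2 <= (e + 1) ^+ 2.
    by rewrite ler_pXn2r ?nnegrE //; lra.
  have : 0 < (e + 1) * (3 * e - 1) by rewrite mulr_gt0 //; lra.
  by lra.
by move: Emu F1; rewrite -F3 F2; lra.
Qed.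

(** * The neighbourhood of a vertex of maximal weight *)

(** For irreflexive [g] a vertex of [S] counts itself, so that part sizes come out without a
    correction by one. *)
Definition nonnb (V : finType) (g : rel V) (S : {set V}) (u : V) : nat :=
  (\sum_(y in S) ~~ g u y)%N.

Lemma sum_nonadj (R : realType) (V : finType) (g : rel V) (S : {set V})
    (z : V -> R) (u : V) :
  \sum_(y in S) (g u y)%:R * z y
    = \sum_(y in S) z y - \sum_(y in S) (~~ g u y)%:R * z y.
Proof.
rewrite -sumrB; apply: eq_bigr => y _.
by case: (g u y) => /=; rewrite ?mul1r ?mul0r ?subr0 ?subrr.
Qed.

Lemma sum_ge0_eq0 (R : realType) (V : finType) (S : {set V}) (F : V -> R) :
  (forall u, u \in S -> 0 <= F u) -> \sum_(u in S) F u <= 0 ->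
  forall u, u \in S -> F u = 0.
Proof.
move=> F0 sF u uS; apply/le_anti; rewrite F0 // andbT.
apply: le_trans sF; rewrite (bigD1 u) //= lerDl.
by apply: sumr_ge0 => y /andP[yS _]; exact: F0.
Qed.

(* Here [w = 1 - x] on the neighbourhood [S] of a vertex where [x = 1], and
   [tau u] is the weight that [u] misses outside [S]; in the extremal graph
   [tau = 0] and [w] vanishes on the parts of size [k]. *)
Lemma neighbourhood_gap (R : realType) (V : finType) (g : rel V) (S : {set V})
    (w tau : V -> R) (k : nat) (lam L mu : R) (d : R := #|S|%:R) :
  symmetric g -> irreflexive g -> (0 < k)%N -> (0 < #|S|)%N ->
  (forall u, u \in S -> 0 <= w u) -> (forall u, u \in S -> 0 <= tau u) ->
  (forall u, u \in S -> lam * w u + \sum_(y in S) (~~ g u y)%:R * w y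
     = (nonnb g S u)%:R - k%:R + tau u) ->
  \sum_(u in S) w u = d - lam -> L <= lam -> d - 1 <= L ->
  (d - L) * (L + k%:R + 1) = (d - k%:R - mu) * (mu + k%:R + 1) ->
  d - k%:R - 1 <= mu -> 0 <= mu ->
  (forall z : V -> R, \sum_(u in S) \sum_(y in S) (g u y)%:R * z u * z y
     <= mu * \sum_(u in S) z u ^+ 2) ->
  lam = L /\
  forall u, u \in S -> tau u = 0 /\
   (nonnb g S u = k /\ w u = 0 \/
    [/\ nonnb g S u = k.+1, 0 < w u & (L + k%:R + 1) * w u = 1]) /\
   (forall y, y \in S -> ~~ g u y -> w y = w u).
Proof.
move=> g_sym g_irr k_gt0 S_gt0 w_ge0 tau_ge0.
pose h u y : R := (~~ g u y)%:R.
pose m u : R := (nonnb g S u)%:R.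
pose M u : R := \sum_(y in S) h u y * w y.
move=> w_eq0; have w_eq u (uS : u \in S) : lam * w u + M u = m u - k%:R + tau u.
  exact: w_eq0.
clear w_eq0; move=> w_sum L_lam L_ge LmuE mu_ge mu_ge0 rayleigh.
have k1 : 1 <= k%:R :> R.
  by rewrite ler1n.
have d1 : 1 <= d.
  by rewrite ler1n.
have h_sym u y : h u y = h y u.
  by rewrite /h g_sym.
have mE u : m u = \sum_(y in S) h u y.
  by rewrite /m natr_sum.
have w_le u : u \in S -> w u <= d - lam.
  move=> uS; rewrite -w_sum (bigD1 u) //= lerDl.
  by apply: sumr_ge0 => y /andP[yS _]; exact: w_ge0.
have lam_le : lam <= d.
  by rewrite -subr_ge0 -w_sum; apply: sumr_ge0.
have L_ge0 : 0 <= L.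
  by lra.
have muL : mu < L.
  rewrite ltNge; apply/negP => Lmu.
  (* The chain [d - 1 <= L <= mu <= d - k] with [1 <= k] forces [mu = d - k]; then the right side of
     [LmuE] vanishes while its left side is positive. *)
  have a0 : 0 <= d - k%:R - mu.
    have : 0 <= (d - k%:R - mu) * (mu + k%:R + 1).
      by rewrite -LmuE mulr_ge0 //; lra.
    by rewrite pmulr_lge0 //; lra.
  have muE : mu = d - k%:R by lra.
  have : 0 < (d - L) * (L + k%:R + 1) by rewrite mulr_gt0 //; lra.
  by rewrite LmuE muE subrr mul0r ltxx.
(* In the extremal graph [1 - c w] is the Perron vector of [S]. *)
pose c : R := (L + k%:R + 1) / (mu + k%:R + 1).
have cE : c * (mu + k%:R + 1) = L + k%:R + 1.
  by rewrite /c divfK // gt_eqF //; lra.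
have c_gt1 : 1 < c.
  by rewrite /c ltr_pdivlMr; lra.
have cdL : c * (d - L) = d - k%:R - mu.
  have e0 : mu + k%:R + 1 != 0 by rewrite gt_eqF //; lra.
  by apply: (mulIf e0); rewrite -LmuE -cE; ring.
pose z u : R := 1 - c * w u.
have z_ge0 u : u \in S -> 0 <= z u.
  move=> uS; have : c * w u <= c * (d - L).
    by rewrite ler_pM2l; [have := w_le _ uS; lra | lra].
  by rewrite cdL /z; lra.
pose T u : R := tau u + (c - 1) * (m u - k%:R - 1) * w u.
have M_ge u : u \in S -> w u <= M u.
  move=> uS; rewrite /M (bigD1 u) //= /h g_irr mul1r lerDl.
  by apply: sumr_ge0 => y /andP[yS _]; rewrite mulr_ge0 // w_ge0.
have m_ge1 u : u \in S -> 1 <= m u.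
  by move=> uS; rewrite /m ler1n /nonnb (bigD1 u) //= g_irr.
have ckL : (c - 1) * k%:R < lam.
  apply: lt_le_trans L_lam; have e0 : 0 < mu + k%:R + 1 by lra.
  rewrite -(ltr_pM2r e0); have -> : (c - 1) * k%:R * (mu + k%:R + 1)
    = k%:R * (c * (mu + k%:R + 1) - (mu + k%:R + 1)) by ring.
  rewrite cE; have : 0 <= k%:R * mu by rewrite mulr_ge0.
  have : 0 <= L * mu by rewrite mulr_ge0.
  by lra.
(* Here the degree term of [T] may be negative. Expressing [tau u] through [w_eq] brings in
   [lam * w u], which by [ckL] outweighs the loss [(c - 1) * k * w u]. Since [m u] is an integer,
   the only other case is [k + 1 <= m u], where both terms of [T] are nonnegative. *)
have T_low u : u \in S -> (nonnb g S u <= k)%N ->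
  (lam - (c - 1) * k%:R) * w u + (k%:R - m u) <= T u.
  move=> uS mk; have mkR : m u <= k%:R by rewrite ler_nat.
  have tE : tau u = lam * w u + M u - m u + k%:R by rewrite w_eq //; ring.
  have : 0 <= (c - 1) * w u * (m u - 1).
    have := m_ge1 _ uS; have := w_ge0 _ uS => ? ?.
    by rewrite !mulr_ge0 //; lra.
  by have := M_ge _ uS; have := w_ge0 _ uS; rewrite /T tE; lra.
have T_ge0 u : u \in S -> 0 <= T u.
  move=> uS; have wu := w_ge0 _ uS; have [mk|mk] := leqP (nonnb g S u) k.
    apply: le_trans (T_low _ uS mk); have mkR : m u <= k%:R by rewrite ler_nat.
    by rewrite addr_ge0 ?subr_ge0 // mulr_ge0 // subr_ge0 ltW.
  have mkR : k%:R + 1 <= m u by rewrite natr1 ler_nat.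
  have ? := tau_ge0 _ uS.
  by rewrite /T addr_ge0 // !mulr_ge0 //; lra.
pose D := \sum_(u in S) \sum_(y in S) h u y * (w u - w y) ^+ 2.
have D_ge0 : 0 <= D.
  by apply: sumr_ge0 => u _; apply: sumr_ge0 => y _; rewrite mulr_ge0 ?sqr_ge0.
have sumM : \sum_(u in S) M u = \sum_(u in S) m u * w u.
  rewrite /M exchange_big /=; apply: eq_bigr => y _.
  by rewrite mE mulr_suml; apply: eq_bigr => u _; rewrite h_sym.
(* [D] is twice the Laplacian form of the complement of [g] on [S]: degree term minus adjacency
   term. *)
have sumwM :
  2 * \sum_(u in S) w u * M u = 2 * (\sum_(u in S) m u * w u ^+ 2) - D.
  have e1 : \sum_(u in S) m u * w u ^+ 2
      = \sum_(u in S) \sum_(y in S) h u y * w u ^+ 2.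
    by apply: eq_bigr => u _; rewrite mE mulr_suml.
  have e2 : \sum_(u in S) m u * w u ^+ 2
      = \sum_(u in S) \sum_(y in S) h u y * w y ^+ 2.
    rewrite e1 exchange_big /=; apply: eq_bigr => u _.
    by apply: eq_bigr => y _; rewrite h_sym.
  suff -> : D = \sum_(u in S) \sum_(y in S) h u y * w u ^+ 2
      + \sum_(u in S) \sum_(y in S) h u y * w y ^+ 2
      - 2 * \sum_(u in S) w u * M u by rewrite -e1 -e2; ring.
  rewrite /D -big_split /= mulr_sumr -sumrB; apply: eq_bigr => u _.
  rewrite -big_split /= /M !mulr_sumr -sumrB; apply: eq_bigr => y _; ring.
have quad :
  \sum_(u in S) \sum_(y in S) (g u y)%:R * z u * z y
    - mu * \sum_(u in S) z u ^+ 2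
  = (lam - L) * \sum_(u in S) z u * (c - w u) + \sum_(u in S) z u * T u
    + (c - 1) * c / 2 * D.
  have zs : \sum_(u in S) z u = d - c * (d - lam).
    by rewrite /z sumrB sumr_const -mulr_sumr w_sum.
  have row u : u \in S -> \sum_(y in S) (g u y)%:R * z u * z y - mu * z u ^+ 2
      = (lam - L) * (z u * (c - w u)) + z u * tau u
        + (c - 1) * (z u * (M u - (k%:R + 1) * w u)).
    move=> uS; rewrite (eq_bigr (fun y => z u * ((g u y)%:R * z y))); last first.
      by move=> y _; ring.
    rewrite -mulr_sumr sum_nonadj zs.
    have -> : \sum_(y in S) (~~ g u y)%:R * z y = m u - c * M u.
      rewrite mE /M mulr_sumr -sumrB; apply: eq_bigr => y _.
      by rewrite /z /h; ring.
    have mu_eq : m u = lam * w u + M u + k%:R - tau u by rewrite w_eq //; ring.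
    have c1 := cdL; have c2 : c * mu = L + k%:R + 1 - c * k%:R - c.
      by rewrite -cE; ring.
    have c3 : d - k%:R - mu = c * d - c * L by rewrite -cdL; ring.
    rewrite mu_eq.
    transitivity (z u * ((d - k%:R - mu) - c * d + c * lam - lam * w u - M u
       + tau u + c * M u + c * mu * w u)).
      by rewrite /z; ring.
    by rewrite c3 c2; ring.
  rewrite mulr_sumr -sumrB (eq_bigr _ row) !big_split /= -!mulr_sumr -!addrA.
  congr (_ + _).
  (* Only after summation can [M u] be traded for [m u * w u]: the linear part by double counting
     ([sumM]), the quadratic part at the cost of [D] ([sumwM]). *)
  have -> : \sum_(u in S) z u * (M u - (k%:R + 1) * w u)
      = \sum_(u in S) z u * (m u - k%:R - 1) * w u + c / 2 * D.
    have : \sum_(u in S) z u * (M u - (k%:R + 1) * w u)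
        = \sum_(u in S) M u - c * \sum_(u in S) w u * M u
          - \sum_(u in S) z u * (k%:R + 1) * w u.
      rewrite mulr_sumr -!sumrB; apply: eq_bigr => u _; rewrite /z; ring.
    have : \sum_(u in S) z u * (m u - k%:R - 1) * w u
        = \sum_(u in S) m u * w u - c * \sum_(u in S) m u * w u ^+ 2
          - \sum_(u in S) z u * (k%:R + 1) * w u.
      rewrite mulr_sumr -!sumrB; apply: eq_bigr => u _; rewrite /z; ring.
    move=> -> ->; rewrite sumM.
    have -> : D = 2 * \sum_(u in S) m u * w u ^+ 2 - 2 * \sum_(u in S) w u * M u.
      by rewrite sumwM; ring.
    by field.
  rewrite mulrDr addrA mulr_sumr -big_split /=; congr (_ + _); last by ring.
  by apply: eq_bigr => u _; rewrite /T; ring.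
have parts : [/\ (lam - L) * \sum_(u in S) z u * (c - w u) = 0,
  forall u, u \in S -> z u * T u = 0 & D = 0].
  have := rayleigh z; rewrite -subr_le0 quad.
  have cw u : u \in S -> 0 <= c - w u.
    by move=> uS; have := w_le _ uS; lra.
  have P1 : 0 <= (lam - L) * \sum_(u in S) z u * (c - w u).
    rewrite mulr_ge0 ?subr_ge0 //; apply: sumr_ge0 => u uS.
    by rewrite mulr_ge0 ?z_ge0 ?cw.
  have P2 : 0 <= \sum_(u in S) z u * T u.
    by apply: sumr_ge0 => u uS; rewrite mulr_ge0 ?z_ge0 ?T_ge0.
  have cc : 0 < (c - 1) * c / 2.
    by rewrite !mulr_gt0 // ?invr_gt0; lra.
  have P3 : 0 <= (c - 1) * c / 2 * D by rewrite mulr_ge0 // ltW.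
  move=> sum0; split; first lra.
    apply: sum_ge0_eq0 => [u uS|]; first by rewrite mulr_ge0 ?z_ge0 ?T_ge0.
    lra.
  have : (c - 1) * c / 2 * D = 0 by lra.
  by move/eqP; rewrite mulf_eq0 (gt_eqF cc) => /eqP.
have lamE : lam = L.
  have [P _ _] := parts; move/eqP: P; rewrite mulf_eq0 subr_eq0.
  case/orP => /eqP // P; apply/eqP; rewrite eq_le L_lam andbT leNgt.
  (* With [L < lam] the bound [w y <= d - lam] lies strictly below [d - L], so every
     [z y * (c - w y)] is positive and the sum over the nonempty [S] cannot vanish. *)
  apply/negP => lt; have [u uS] : exists u, u \in S by apply/set0Pn; rewrite -card_gt0.
  have pos y : y \in S -> 0 < z y * (c - w y).
    move=> yS; apply: mulr_gt0; last by have := w_le _ yS; lra.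
    have : c * w y < c * (d - L).
      by rewrite ltr_pM2l; [have := w_le _ yS; lra | lra].
    by rewrite cdL /z; lra.
  have := sum_ge0_eq0 (fun y yS => ltW (pos y yS)).
  rewrite P => /(_ (lexx _) u uS) e; by have := pos u uS; rewrite e ltxx.
have w_const u y : u \in S -> y \in S -> ~~ g u y -> w u = w y.
  move=> uS yS guy; have [_ _ D0] := parts.
  have := sum_ge0_eq0 (S := S) (F := fun u => \sum_(y in S) h u y * (w u - w y) ^+ 2).
  rewrite -/D D0 => /(_ _ (lexx _) u uS) => Du.
  have {}Du : \sum_(y in S) h u y * (w u - w y) ^+ 2 <= 0.
    rewrite Du // => x _; apply: sumr_ge0 => t _.
    by rewrite mulr_ge0 ?sqr_ge0.
  have := sum_ge0_eq0 (fun t _ => mulr_ge0 (ler0n _ _) (sqr_ge0 _)) Du yS.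
  by rewrite guy mul1r => /eqP; rewrite sqrf_eq0 subr_eq0 => /eqP.
(* If [z u = 0] then [w] is concentrated at [u] and [u] is joined to the rest
   of [S]; the average degree of [S] is then too large. *)
have z_neq0 u : u \in S -> z u != 0.
  move=> uS; apply/negP => /eqP zu.
  have cw : c * w u = 1 by move: zu; rewrite /z; lra.
  have wu : w u = d - L.
    apply/le_anti; have := w_le _ uS; rewrite lamE => -> /=.
    rewrite -(@ler_pM2l _ c); last by lra.
    by rewrite cw cdL; lra.
  have muE : mu = d - k%:R - 1 by have := cdL; rewrite -wu cw; lra.
  have w0 y : y \in S -> y != u -> w y = 0.
    move=> yS yu; have := w_sum; rewrite (bigD1 u) //= lamE wu => e.
    have e0 : \sum_(y in S | y != u) w y = 0 by lra.
    apply/le_anti; rewrite w_ge0 // andbT -e0 (bigD1 y) ?yS //= lerDl.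
    by apply: sumr_ge0 => x /andP[/andP[xS _] _]; exact: w_ge0.
  have adj y : y \in S -> y != u -> g u y.
    move=> yS yu; case: (boolP (g u y)) => // guy.
    have := w_const _ _ uS yS guy; rewrite (w0 y) // => e.
    by move: cw; rewrite e mulr0; lra.
  have mk y : y \in S -> m y <= k%:R.
    move=> yS; have [->|yu] := eqVneq y u.
      apply: le_trans k1; rewrite mE (bigD1 u) //= big1 ?addr0 /h ?g_irr //.
      by move=> x /andP[xS xu]; rewrite adj.
    have [_ /(_ y yS) + _] := parts; rewrite /z /T w0 // !mulr0 subr0 mul1r addr0.
    move=> ty; have := w_eq _ yS; rewrite w0 // ty mulr0 add0r addr0.
    have -> : M y = 0; last by lra.
    rewrite /M big1 // => x xS; have [->|xu] := eqVneq x u.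
      by rewrite /h g_sym adj // mul0r.
    by rewrite w0 // mulr0.
  have := rayleigh (fun=> 1).
  have -> : \sum_(u in S) \sum_(y in S) (g u y)%:R * 1 * 1
      = \sum_(u in S) (d - m u).
    apply: eq_bigr => x _; under eq_bigr => y _ do rewrite -mulrA mulr1.
    rewrite sum_nonadj mE sumr_const; congr (_ - _).
    by apply: eq_bigr => y _; rewrite mulr1.
  have -> : \sum_(u in S) 1 ^+ 2 = d :> R.
    by rewrite /d -sum1_card natr_sum; apply: eq_bigr => y _; rewrite expr1n.
  have : \sum_(u in S) (d - k%:R) <= \sum_(u in S) (d - m u).
    by apply: ler_sum => y yS; have := mk y yS; lra.
  rewrite sumr_const -[_ *+ #|S|]mulr_natr -/d => h1 h2.
  have := le_trans h1 h2; rewrite ler_pM2r; [lra | lra].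
split=> [|u uS]; first exact: lamE.
have [_ /(_ u uS)/eqP + _] := parts; rewrite mulf_eq0 (negPf (z_neq0 _ uS)) /=.
move=> /eqP T0; have wu := w_ge0 _ uS; have Mw : M u = m u * w u.
  rewrite mE mulr_suml; apply: eq_bigr => y yS; rewrite /h.
  by case: (boolP (g u y)) => guy; rewrite ?mul0r ?mul1r // (w_const _ _ uS yS).
suff [t0 W] : tau u = 0 /\ (nonnb g S u = k /\ w u = 0 \/
    [/\ nonnb g S u = k.+1, 0 < w u & (L + k%:R + 1) * w u = 1]).
  by split=> //; split=> // y yS guy; rewrite (w_const _ _ uS yS).
have [mk|mk] := leqP (nonnb g S u) k.
  have := T_low _ uS mk; rewrite T0; have mkR : m u <= k%:R by rewrite ler_nat.
  have P : 0 <= (lam - (c - 1) * k%:R) * w u.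
    by rewrite mulr_ge0 // subr_ge0 ltW.
  move=> le0; have mkE : m u = k%:R by lra.
  have w0 : w u = 0.
    have /eqP : (lam - (c - 1) * k%:R) * w u = 0 by lra.
    by rewrite mulf_eq0 subr_eq0 (gt_eqF ckL) => /eqP.
  split; first by move: T0; rewrite /T w0 mulr0 addr0.
  by left; split=> //; apply/eqP; rewrite -(eqr_nat R); apply/eqP.
have mkR : k%:R + 1 <= m u by rewrite natr1 ler_nat.
(* With [w u = 0] the left side of [w_eq] would be [0], while its right side is at least [1]. *)
have w_gt0 : 0 < w u.
  rewrite lt0r wu andbT; apply/eqP => w0; have := w_eq _ uS.
  by rewrite Mw w0 !mulr0; have := tau_ge0 _ uS; lra.
have t0 := tau_ge0 _ uS; have cm : 0 <= (c - 1) * (m u - k%:R - 1) * w u.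
  by rewrite !mulr_ge0 //; lra.
have tu : tau u = 0 by move: T0; rewrite /T; lra.
split=> //; right; have : (c - 1) * (m u - k%:R - 1) * w u = 0.
  by move: T0; rewrite /T tu add0r.
have c0 : c - 1 != 0 by rewrite subr_eq0 gt_eqF // c_gt1.
move/eqP; rewrite !mulf_eq0 (negPf c0) (gt_eqF w_gt0) orbF /= => /eqP e.
have mE1 : m u = k%:R + 1 by lra.
split=> //; first by apply/eqP; rewrite -(eqr_nat R) -natr1; apply/eqP.
by have := w_eq _ uS; rewrite Mw tu mE1 lamE; lra.
Qed.

Lemma cauchy_sum (R : realType) (V : finType) (S : {set V}) (x : V -> R) :
  (\sum_(u in S) x u) ^+ 2 <= #|S|%:R * \sum_(u in S) x u ^+ 2.
Proof.
set d : R := #|S|%:R; have [s sE] : exists s, s = \sum_(u in S) x u by eexists.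
rewrite -sE.
have [S0|S0] := posnP #|S|.
  have e : S = finset.set0 by apply/eqP; rewrite -cards_eq0 S0.
  by rewrite sE e !big_set0 expr0n mulr0.
have : 0 <= \sum_(u in S) (d * x u - s) ^+ 2.
  by apply: sumr_ge0 => u _; exact: sqr_ge0.
have -> : \sum_(u in S) (d * x u - s) ^+ 2
    = d * (d * \sum_(u in S) x u ^+ 2 - s ^+ 2).
  transitivity (d ^+ 2 * \sum_(u in S) x u ^+ 2 - 2 * d * s * \sum_(u in S) x u
     + \sum_(u in S) s ^+ 2).
    rewrite !mulr_sumr -sumrB -big_split /=; apply: eq_bigr => u _; ring.
  rewrite sumr_const -[_ *+ #|S|]mulr_natr -sE -/d; ring.
by rewrite pmulr_rge0 ?ltr0n // subr_ge0.
Qed.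

(** Weighting the row inequality at [u] by [x u] and summing gives [(lam - mu) * X <= k * lam],
    where [X] is the sum of squares; Cauchy-Schwarz bounds [X] below by [lam ^+ 2] over the size of
    [S]. *)
Lemma max_vertex_far (R : realType) (V : finType) (g : rel V) (S : {set V})
    (x : V -> R) (lam L mu k : R) :
  (forall u, u \in S -> 0 <= x u) -> \sum_(u in S) x u = lam -> 0 <= k ->
  0 < L -> L <= lam ->
  (forall u, u \in S -> lam * x u <= \sum_(y in S) (g u y)%:R * x y + k) ->
  \sum_(u in S) \sum_(y in S) (g u y)%:R * x u * x y
    <= mu * \sum_(u in S) x u ^+ 2 ->
  L * (L - mu) <= k * #|S|%:R.
Proof.
move=> x0 xs k0 L0 Llam xk ray; set d : R := #|S|%:R.
set X := \sum_(u in S) x u ^+ 2 in ray.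
have cs : lam ^+ 2 <= d * X by rewrite -xs; exact: cauchy_sum.
have lamX : lam * X <= mu * X + k * lam.
  apply: le_trans (_ : _ <= \sum_(u in S) \sum_(y in S) (g u y)%:R * x u * x y
    + k * lam) _; last by rewrite lerD2r.
  have -> : k * lam = \sum_(u in S) k * x u by rewrite -xs mulr_sumr.
  rewrite /X mulr_sumr -big_split /=; apply: ler_sum => u uS.
  have := ler_wpM2l (x0 u uS) (xk u uS); rewrite mulrDr mulr_sumr.
  have -> : \sum_(y in S) x u * ((g u y)%:R * x y)
     = \sum_(y in S) (g u y)%:R * x u * x y.
    by apply: eq_bigr => y _; ring.
  by lra.
have d0 : 0 <= d by [].
have [Lmu|Lmu] := lerP (L - mu) 0.
  apply: le_trans (_ : 0 <= _); last by rewrite mulr_ge0.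
  by rewrite mulr_ge0_le0 // ltW.
have lam0 : 0 < lam by lra.
have h1 : (lam - mu) * lam ^+ 2 <= (lam - mu) * (d * X).
  by rewrite ler_wpM2l //; lra.
have h2 : d * ((lam - mu) * X) <= d * (k * lam).
  by rewrite ler_wpM2l //; lra.
have h3 : lam * (lam - mu) <= k * d by rewrite -(ler_pM2r lam0); lra.
apply: le_trans h3; apply: le_trans (_ : lam * (L - mu) <= _).
  by rewrite ler_wpM2r // ltW.
by rewrite ler_wpM2l //; lra.
Qed.

(** The vertices outside [nbhd g v], with [v] among them, number at most [q]. Fewer than [q]
    contradicts [turan_gap] through [max_vertex_far]; exactly [q] is the situation of
    [neighbourhood_gap], whose equality case is the conclusion. *)
Lemma max_vertex_gap (R : realType) (r n : nat) (g : rel 'I_n) (x : 'I_n -> R)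
    (v : 'I_n) (lam : R) (L := lambda R (turan r n)) (q := (n %/ r)%N) :
  (2 <= r)%N -> (r <= n)%N -> symmetric g -> irreflexive g ->
  (forall u, 0 <= x u) -> (forall u, x u <= 1) -> x v = 1 ->
  (forall u, \sum_y (g u y)%:R * x y = lam * x u) -> L <= lam ->
  lambda_ind R g (nbhd g v) <= lambda R (turan r.-1 (deg g v)) ->
  [/\ lam = L, (deg g v + q = n)%N,
      forall u y, g v u -> ~~ g v y -> g u y /\ x y = 1 &
      forall u, g v u ->
        (nonnb g (nbhd g v) u = q /\ x u = 1 \/
         [/\ nonnb g (nbhd g v) u = q.+1, x u < 1
           & (L + q%:R + 1) * (1 - x u) = 1]) /\
        (forall y, g v y -> ~~ g u y -> x y = x u)].
Proof.
move=> r2 rn g_sym g_irr x_ge0 x_le1 xv xeig Llam ind_le.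
set S := nbhd g v; set mu := lambda R (turan r.-1 (deg g v)) in ind_le.
have r0 : (0 < r)%N by exact: ltnW.
have s0 : (0 < r.-1)%N by rewrite -ltnS prednK.
have inS y : (y \in S) = g v y by rewrite inE.
have [LE Lge] := lambda_turan R n r0; rewrite -/L -/q in LE Lge.
set j := (n %% r)%N in LE; have nE : n = (q * r + j)%N := divn_eq n r.
have jr : (j < r)%N := ltn_pmod n r0.
have js : (j <= r.-1)%N by rewrite -ltnS prednK.
have qr : (q * r = q * r.-1 + q)%N by rewrite -{1}(prednK r0) mulnS addnC.
have q_gt0 : (0 < q)%N by rewrite divn_gt0.
have [muE muge] := lambda_turan R (deg g v) s0; rewrite -/mu in muE muge.
have mu0 : 0 <= mu by exact: spec_rad_ge0.
have dE : deg g v = #|S| by [].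
rewrite dE in muE muge *; set d := #|S| in muE muge *.
have nER : n%:R = q%:R * r%:R + j%:R :> R by rewrite -natrM -natrD -nE.
have qR : 1 <= q%:R :> R by rewrite ler1n.
have rR : 2 <= r%:R :> R by rewrite ler_nat.
have sR : (r.-1)%:R = r%:R - 1 :> R by rewrite -[in RHS](prednK r0) -natr1 addrK.
have jR0 : 0 <= j%:R :> R by [].
have jR : j%:R + 1 <= r%:R :> R by rewrite natr1 ler_nat.
have xS : \sum_(u in S) x u = lam.
  rewrite -[RHS]mulr1 -xv -xeig big_mkcond; apply: eq_bigr => y _.
  by rewrite inS; case: (g v y); rewrite ?mul1r ?mul0r.
have lam_d : lam <= d%:R.
  by rewrite -xS /d -sum1_card natr_sum; apply: ler_sum => u _.
(* Equality in [Lge] would turn [LE] into [n = j * (q + 1)], impossible as [n = q * r + j] with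
   [j < r] and [0 < q]. *)
have L_gt : n%:R - q%:R - 1 < L.
  rewrite lt_neqAle Lge andbT; apply/eqP => e; move: LE; rewrite -e.
  have : 0 < (r%:R - j%:R) * q%:R :> R by rewrite mulr_gt0 //; lra.
  by rewrite nER; lra.
have d_lt : (d < n)%N.
  rewrite -[X in (_ < X)%N](card_ord n); apply: proper_card.
  by apply/properP; split; [exact: subset_predT | exists v; rewrite ?inS ?g_irr].
(* From [n - q - 1 < L <= lam <= d], all of [n], [q] and [d] being integers. *)
have nd : (n <= d + q)%N.
  rewrite -ltnS -(ltr_nat R) -natr1 natrD; lra.
have qL : q%:R <= L.
  have : 0 <= (r%:R - 2) * q%:R :> R by rewrite mulr_ge0 //; lra.
  have [j0|j0] := posnP j.
    have : (n%:R - q%:R - L) * (L + q%:R + 1) = 0 by rewrite LE j0 mul0r.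
    have Lp : 0 <= L by exact: spec_rad_ge0.
    move/eqP; rewrite mulf_eq0 => /orP[/eqP e|/eqP e]; last lra.
    by move: e nER; rewrite j0; lra.
  have : 1 <= j%:R :> R by rewrite ler1n.
  by move: nER Lge; lra.
have row u : lam * x u = \sum_(y in S) (g u y)%:R * x y
    + \sum_(y in ~: S) (g u y)%:R * x y.
  rewrite -xeig (bigID (mem S)) /=; congr (_ + _).
  by apply: eq_bigl => y; rewrite finset.in_setC.
have cardSC : #|~: S| = (n - d)%N.
  by rewrite -[in RHS](card_ord n) -(cardsC S) addKn.
have ray (z : 'I_n -> R) : \sum_(u in S) \sum_(y in S) (g u y)%:R * z u * z y
    <= mu * \sum_(u in S) z u ^+ 2.
  apply: le_trans (lambda_ind_rayleigh S z g_sym) _.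
  by rewrite ler_wpM2r //; apply: sumr_ge0 => u _; exact: sqr_ge0.
have kR : (n - d)%:R = n%:R - d%:R :> R by rewrite natrB // ltnW.
have ndR : n%:R - d%:R <= q%:R :> R by rewrite -kR ler_nat leq_subLR.
move: nd; rewrite leq_eqVlt => /orP[/eqP nd|nd]; last first.
  have ql : (q <= d %/ r.-1)%N.
    rewrite leq_divRL // -(leq_add2r q) -qr; apply: leq_trans (ltnW nd).
    by rewrite nE leq_addr.
  have Evirt := turan_char_le s0 ql muE muge.
  have far : L * (L - mu) <= (n%:R - d%:R) * d%:R.
    apply: (max_vertex_far (fun u _ => x_ge0 u) xS _ _ Llam) (ray x).
    - by rewrite -kR.
    - lra.
    move=> u _; rewrite row lerD2l -kR -cardSC -sum1_card natr_sum.
    apply: ler_sum => y _; case: (g u y); rewrite ?mul1r ?mul0r //.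
  have k1 : 1 <= n%:R - d%:R :> R by rewrite -kR ler1n subn_gt0.
  have kq : n%:R - d%:R <= q%:R - 1 :> R.
    by rewrite -kR lerBrDr natr1 ler_nat ltn_psubLR.
  have dd : n%:R - (n%:R - d%:R) = d%:R :> R by ring.
  have := turan_gap (mu := mu) nER jR0 qR k1 kq LE Lge qL.
  rewrite dd -sR => /(_ Evirt); rewrite ltNge far //.
(* This need not be a Euclidean division by [r.-1], since [j] may equal [r.-1]; hence the detour
   through [turan_char_eq]. *)
have d_eq : d = (r.-1 * q + j)%N by apply: (@addIn q); rewrite -nd nE qr mulnC addnAC.
have [muE' muge'] := turan_char_eq s0 d_eq js muE muge mu0.
have ndR' : n%:R = d%:R + q%:R :> R by rewrite nd natrD.
have k_eq : (n - d = q)%N by rewrite nd addKn.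
pose w u := 1 - x u; pose tau u := \sum_(y in ~: S) (1 - (g u y)%:R * x y).
have term_ge0 u y : 0 <= 1 - (g u y)%:R * x y.
  by case: (g u y); rewrite ?mul1r ?mul0r ?subr_ge0 ?subr0.
have S_gt0 : (0 < #|S|)%N by rewrite -/d d_eq addn_gt0 muln_gt0 s0 q_gt0.
have [] := @neighbourhood_gap R _ g S w tau q lam L mu g_sym g_irr q_gt0 S_gt0.
- by move=> u _; rewrite subr_ge0.
- by move=> u _; apply: sumr_ge0 => y _.
- move=> u _; rewrite /nonnb natr_sum /tau sumrB sumr_const cardSC k_eq.
  have -> : \sum_(y in S) (~~ g u y)%:R * w y
      = \sum_(y in S) (~~ g u y)%:R - \sum_(y in S) (~~ g u y)%:R * x y.
    by rewrite -sumrB; apply: eq_bigr => y _; rewrite /w; ring.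
  by have := row u; rewrite sum_nonadj xS /w; lra.
- by rewrite /w sumrB sumr_const xS.
- exact: Llam.
- by move: ndR' L_gt; rewrite -/d; lra.
- by rewrite -/d muE' -LE ndR'; congr (_ * _); ring.
- exact: muge'.
- exact: mu0.
- exact: ray.
move=> lamE local; split=> [||u y|u]; [exact: lamE | exact: esym nd | |].
  rewrite -!inS => uS yS; have [t0 _] := local u uS.
  (* A single vanishing term of [tau u] forces both adjacency to [y] and [x y = 1]. *)
  have := sum_ge0_eq0 (fun y _ => term_ge0 u y) (_ : tau u <= 0) (u := y).
  rewrite t0 finset.in_setC => /(_ (lexx 0) yS).
  by case: (g u y); rewrite ?mul1r ?mul0r; [split=> //; lra | lra].
rewrite -inS => uS; have [_ [alt const]] := local u uS; split.
  case: alt => [[m0 w0]|[m1 w1 wE]]; [left|right].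
    by split=> //; move: w0; rewrite /w; lra.
  by split=> //; move: w1; rewrite /w; lra.
by move=> y; rewrite -inS => yS guy; have := const y yS guy; rewrite /w; lra.
Qed.

(** * Recognising the Turan graph *)

(** For irreflexive [g] it contains [u]; in a complete multipartite graph it is the part of [u]. *)
Definition coclass (V : finType) (g : rel V) (u : V) : {set V} :=
  [set y | ~~ g u y].

(** The hypotheses make the coclasses the fibres of the map [coclass g], so [P] is counted fibre by
    fibre. *)
Lemma card_coclass_classes (V : finType) (g : rel V) (P : {set V}) (s : nat) :
  irreflexive g -> (forall u y, ~~ g u y -> coclass g y = coclass g u) ->
  (forall u, u \in P -> coclass g u \subset P /\ #|coclass g u| = s) ->
  #|P| = (#|[set coclass g u | u in P]| * s)%N.
Proof.
move=> g_irr cls Ps; rewrite -sum1_card.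
rewrite (partition_big (coclass g) (mem [set coclass g u | u in P])) /=.
  rewrite -sum_nat_const; apply: eq_bigr => _ /imsetP[u uP ->].
  have [sub <-] := Ps u uP; rewrite -sum1_card; apply: eq_bigl => y.
  rewrite inE; apply/andP/idP => [[yP /eqP e]|guy].
    have : y \in coclass g y by rewrite inE g_irr.
    by rewrite e inE.
  by split; [rewrite (fintype.subsetP sub) // inE | rewrite (cls u)].
by move=> u uP; apply: imset_f.
Qed.

(** Equal fibre sizes make the two lists of values rearrangements of each other. *)
Lemma exists_perm_of_counts (n : nat) (phi psi : 'I_n -> nat) :
  (forall c, (exists u, phi u = c) \/ (exists u, psi u = c) ->
     \sum_(u < n) (phi u == c) = \sum_(u < n) (psi u == c))%N ->
  exists f : {perm 'I_n}, forall u, phi u = psi (f u).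
Proof.
move=> h.
have cnt (ph : 'I_n -> nat) c :
    count_mem c [tuple ph i | i < n] = (\sum_(u < n) (ph u == c))%N.
  by rewrite -sum1_count big_map /= big_enum_cond /= big_mkcond.
have : perm_eq [tuple phi i | i < n] [tuple psi i | i < n].
  apply/allP => c; rewrite mem_cat => hc; rewrite /= !cnt; apply/eqP/h.
  by case/orP: hc => /mapP[u _ ->]; [left | right]; exists u.
case/tuple_permP => f e; exists f => u.
have := congr1 (fun s => nth 0%N s u) e.
by rewrite -!tnth_nth !tnth_mktuple.
Qed.

(** Non-adjacency is an equivalence relation whose classes have the part sizes of the Turan graph;
    numbering them suitably turns [g] into the graph of residue classes. *)
Lemma isomorphic_turan (n r q j : nat) (g : rel 'I_n) (P : {set 'I_n}) :
  irreflexive g -> (forall u y, ~~ g u y -> coclass g y = coclass g u) ->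
  (forall u, #|coclass g u| = q + (u \in P))%N -> #|P| = (j * q.+1)%N ->
  n = (r * q + j)%N -> (j < r)%N -> (0 < q)%N -> isomorphic g (turan r n).
Proof.
move=> g_irr cls card_cls cardP nE jr q0.
have mem_self u : u \in coclass g u by rewrite inE g_irr.
have inP u y : y \in coclass g u -> (y \in P) = (u \in P).
  rewrite inE => /cls e; have := card_cls u; rewrite -e card_cls.
  by move/addnI; do 2!case: (_ \in P).
pose A := [set coclass g u | u in P]; pose B := [set coclass g u | u in ~: P].
have cardA : #|A| = j.
  have /eqP := cardP; rewrite (@card_coclass_classes _ g P q.+1) //.
    by rewrite eqn_pmul2r // => /eqP.
  move=> u uP; rewrite card_cls uP addn1; split=> //.
  by apply/fintype.subsetP => y /inP ->.
have cardB : #|B| = (r - j)%N.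
  have := cardsC P; rewrite cardP card_ord.
  rewrite (@card_coclass_classes _ g (~: P) q) //.
    rewrite -/B; move: #|B| => b; rewrite nE => e; apply/eqP.
    by rewrite -(eqn_pmul2r q0); apply/eqP; nia.
  move=> u; rewrite finset.in_setC => /negPf uP; rewrite card_cls uP addn0; split=> //.
  by apply/fintype.subsetP => y /inP e; rewrite finset.in_setC e uP.
(* The classes of size [q + 1] come first, because in [turan] the larger parts are the residues
   below [j]. *)
pose s := enum A ++ enum B.
have s_uniq : uniq s.
  rewrite cat_uniq !enum_uniq /= andbT; apply/hasPn => C.
  rewrite !mem_enum => /imsetP[u uP ->]; apply/imsetP => -[y yP e].
  by move: uP; rewrite finset.in_setC -(inP u y) ?yP // e mem_self.
have s_size : size s = r by rewrite size_cat -!cardE cardA cardB; lia.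
have mem_s u : coclass g u \in s.
  rewrite mem_cat !mem_enum; case: (boolP (u \in P)) => uP.
    by rewrite imset_f.
  by rewrite orbC imset_f // finset.in_setC.
pose phi u := index (coclass g u) s.
have phi_lt u : (phi u < r)%N by rewrite -s_size index_mem.
have [c|f fE] := @exists_perm_of_counts n phi (fun u => u %% r)%N.
  move=> hc; have cr : (c < r)%N.
    by case: hc => -[u <-]; [exact: phi_lt | apply: ltn_pmod; lia].
  have nq : (n %/ r = q)%N by rewrite nE mulnC divnMDl ?divn_small ?addn0 //; lia.
  have nj : (n %% r = j)%N by rewrite nE mulnC modnMDl modn_small.
  rewrite sum_modn_eq // nq nj.
  have cs : (c < size s)%N by rewrite s_size.
  have phiE u : (phi u == c) = (coclass g u == nth finset.set0 s c).
    apply/eqP/eqP => [<-|e]; first by rewrite nth_index.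
    by rewrite /phi e index_uniq.
  have [u0 u0E] : exists u, nth finset.set0 s c = coclass g u.
    have := mem_nth finset.set0 cs; rewrite mem_cat !mem_enum.
    by case/orP => /imsetP[u _ ->]; exists u.
  have u0P : (u0 \in P) = (c < j)%N.
    have := u0E; rewrite nth_cat -cardE cardA; case: ifP => cj e.
      have : nth finset.set0 (enum A) c \in A.
        by rewrite -mem_enum mem_nth // -cardE cardA.
      by rewrite e => /imsetP[y yP ey]; rewrite -(inP u0 y) // ey.
    have : nth finset.set0 (enum B) (c - j) \in B.
      by rewrite -mem_enum mem_nth // -cardE cardB; lia.
    rewrite e => /imsetP[y]; rewrite finset.in_setC => /negPf yP ey.
    by rewrite -(inP u0 y) // ey.
  rewrite -u0P -card_cls -sum1_card big_mkcond [RHS]big_mkcond /=.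
  apply: eq_bigr => u _; rewrite phiE u0E [in RHS]inE.
  case: (boolP (g u0 u)) => [gu|/cls ->]; last by rewrite eqxx.
  case: eqP => // e; have := mem_self u; rewrite e inE gu //.
exists f => x y; rewrite /turan -!fE.
case: (boolP (g x y)) => gxy; apply/esym.
  apply/eqP => e; have : coclass g x = coclass g y.
    by rewrite -[LHS](nth_index finset.set0 (mem_s x)) -/(phi x) e nth_index.
  by move=> exy; have := mem_self y; rewrite -exy inE gxy.
by apply/negbTE; rewrite negbK /phi (cls x y).
Qed.

(** * The case of equality *)

(* [z] is the Perron vector of the Turan graph, and [t a] counts the edges at
   [a] that the graph has in excess. *)
Lemma no_excess_edges (R : realType) (V : finType) (g : rel V)
    (S P : {set V}) (t : V -> nat) (q : nat) (mu : R) :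
  0 <= mu -> (0 < q)%N ->
  (forall a y, a \in S -> y \in S -> ~~ g a y -> (y \in P) = (a \in P)) ->
  (forall a, a \in S -> nonnb g S a + t a = q + (a \in P))%N ->
  #|S|%:R * (mu + q%:R + 1) - #|S :&: P|%:R = (mu + q%:R) * (mu + q%:R + 1) ->
  (forall z : V -> R, \sum_(u in S) \sum_(y in S) (g u y)%:R * z u * z y
     <= mu * \sum_(u in S) z u ^+ 2) ->
  forall a, a \in S -> t a = 0%N.
Proof.
move=> mu0 q0 PS tS sumE ray.
have q1 : 1 <= q%:R :> R by rewrite ler1n.
pose z y : R := mu + q%:R + 1 - (y \in P)%:R.
have z_gt0 y : 0 < z y by rewrite /z; case: (_ \in P); rewrite /=; lra.
have zs : \sum_(y in S) z y = (mu + q%:R) * (mu + q%:R + 1).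
  rewrite -sumE /z sumrB sumr_const -[_ *+ #|S|]mulr_natr mulrC; congr (_ - _).
  rewrite -natr_sum -sum1_card big_mkcond [in RHS]big_mkcond; congr (_%:R).
  by apply: eq_bigr => y _; rewrite inE; case: (_ \in S); case: (_ \in P).
have row a : a \in S -> \sum_(y in S) (g a y)%:R * z a * z y
    = mu * z a ^+ 2 + (t a)%:R * z a ^+ 2.
  move=> aS; transitivity (z a * \sum_(y in S) (g a y)%:R * z y).
    by rewrite mulr_sumr; apply: eq_bigr => y _; ring.
  rewrite sum_nonadj zs.
  have -> : \sum_(y in S) (~~ g a y)%:R * z y = (nonnb g S a)%:R * z a.
    rewrite natr_sum mulr_suml; apply: eq_bigr => y yS.
    by case: (boolP (g a y)) => gay; rewrite ?mul0r ?mul1r // /z (PS a).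
  have := congr1 (fun m => m%:R : R) (tS a aS); rewrite !natrD => tE.
  have -> : (nonnb g S a)%:R = q%:R + (a \in P)%:R - (t a)%:R :> R.
    by rewrite -tE addrK.
  have -> : (mu + q%:R) * (mu + q%:R + 1) = (mu + q%:R + (a \in P)%:R) * z a.
    by rewrite /z; case: (a \in P) => /=; ring.
  ring.
(* The form at [z] exceeds [mu] times the squared norm by the sum of [t a * z a ^+ 2], for which the
   Rayleigh bound leaves no room. *)
have := ray z; rewrite (eq_bigr _ row) big_split /= -mulr_sumr gerDl => le0 a aS.
have := sum_ge0_eq0 (fun a _ => mulr_ge0 (ler0n R (t a)) (sqr_ge0 (z a))) le0 aS.
move/eqP; rewrite mulf_eq0 sqrf_eq0 (gt_eqF (z_gt0 a)) orbF.
by rewrite pnatr_eq0 => /eqP.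
Qed.

Lemma nonnbE (V : finType) (g : rel V) (S : {set V}) (u : V) :
  nonnb g S u = #|S :&: coclass g u|.
Proof.
rewrite /nonnb -sum1_card big_mkcond [RHS]big_mkcond; apply: eq_bigr => y _.
by rewrite !inE; case: (y \in S); case: (g u y).
Qed.

Lemma card_coclass_deg (n : nat) (g : rel 'I_n) (u : 'I_n) :
  (#|coclass g u| + deg g u = n)%N.
Proof.
have -> : coclass g u = ~: nbhd g u by apply/setP => y; rewrite !inE.
by rewrite addnC cardsC card_ord.
Qed.

Lemma equality_case (R : realType) (r n : nat) (g : rel 'I_n) (x : 'I_n -> R)
    (v : 'I_n) :
  (2 <= r)%N -> (r <= n)%N -> symmetric g -> irreflexive g ->
  (forall u, 0 <= x u) -> (forall u, x u <= 1) -> x v = 1 ->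
  (forall u, \sum_y (g u y)%:R * x y = lambda R (turan r n) * x u) ->
  (forall u, lambda_ind R g (nbhd g u) <= lambda R (turan r.-1 (deg g u))) ->
  isomorphic g (turan r n).
Proof.
move=> r2 rn g_sym g_irr x_ge0 x_le1 xv xeig ind.
set L := lambda R (turan r n) in xeig *; pose q := (n %/ r)%N.
have r0 : (0 < r)%N by exact: ltnW.
have s0 : (0 < r.-1)%N by rewrite -ltnS prednK.
have q_gt0 : (0 < q)%N by rewrite divn_gt0.
pose j := (n %% r)%N; have nE : n = (r * q + j)%N by rewrite mulnC -divn_eq.
have jr : (j < r)%N := ltn_pmod n r0.
have qr : (r * q = r.-1 * q + q)%N by rewrite -{1}(prednK r0) mulSn addnC.
have loc u (xu : x u = 1) :=
  max_vertex_gap r2 rn g_sym g_irr x_ge0 x_le1 xu xeig (lexx L) (ind u).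
pose P := [set u | x u < 1]; have inP u : (u \in P) = (x u < 1) by rewrite inE.
have notP u : (u \in P) = false -> x u = 1.
  by rewrite inP => /negbT; rewrite -leNgt => h; apply/le_anti; rewrite x_le1 h.
have has_nb u : x u = 1 -> exists a, g u a.
  move=> xu; have [_ du _ _] := loc u xu.
  have : (0 < deg g u)%N.
    rewrite -(ltn_add2r q) add0n du nE qr -addnA addnC -addnA.
    by rewrite -[X in (X < _)%N]addn0 ltn_add2l addnC addn_gt0 muln_gt0 s0 q_gt0.
  by rewrite card_gt0 => /set0Pn[a]; rewrite inE; exists a.
have P_nb u : u \in P -> g v u.
  move=> uP; case: (boolP (g v u)) => // gvu; have [a gva] := has_nb v xv.
  have [_ _ /(_ a u gva gvu) [_ e] _] := loc v xv.
  by move: uP; rewrite inP e ltxx.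
have P_sub u : u \in P -> coclass g u \subset nbhd g v.
  move=> uP; apply/fintype.subsetP => y; rewrite !inE => guy.
  case: (boolP (g v y)) => // gvy; have [_ _ /(_ u y (P_nb u uP) gvy) [h _] _] :=
    loc v xv; by rewrite h in guy.
have card_cls u : (#|coclass g u| = q + (u \in P))%N.
  case: (boolP (u \in P)) => [uP|/negbTE uP].
    have [_ _ _ /(_ u (P_nb u uP)) [alt _]] := loc v xv.
    move: uP alt; rewrite inP => xu1; rewrite nonnbE (finset.setIidPr _).
      by move=> [[_ e]|[-> _ _]]; [rewrite e ltxx in xu1 | rewrite addn1].
    by apply: P_sub; rewrite inP.
  have [_ du _ _] := loc u (notP u uP).
  by apply: (@addIn (deg g u)); rewrite card_coclass_deg addn0 addnC.
have x_const u y : u \in P -> ~~ g u y -> x y = x u.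
  move=> uP guy; have [_ _ _ /(_ u (P_nb u uP)) [_ h]] := loc v xv.
  apply: h => //; have := fintype.subsetP (P_sub u uP) y.
  by rewrite !inE; apply.
have cls_max u y : x u = 1 -> ~~ g u y -> coclass g y = coclass g u.
  move=> xu guy; have [_ _ far _] := loc u xu; have [a gua] := has_nb u xu.
  have [_ xy] := far a y gua guy; apply/eqP; rewrite eqEcard !card_cls !inP.
  rewrite xu xy ltxx leqnn andbT; apply/fintype.subsetP => b; rewrite !inE.
  by apply: contra => gub; have [h _] := far b y gub guy; rewrite g_sym.
have [LE Lge] := lambda_turan R n r0; rewrite -/L -/q -/j in LE Lge.
(* On [nbhd g v] the number [(L + q + 1) * (1 - x u)] is the indicator of [P]. Summing it gives
   [(n - q - L) * (L + q + 1)], evaluated by [LE]. *)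
have cardP : #|P| = (j * q.+1)%N.
  have [_ dv _ alt] := loc v xv; rewrite -/q in dv.
  have dR : n%:R - q%:R = #|nbhd g v|%:R :> R by rewrite -{1}dv natrD addrK.
  have xS : \sum_(u in nbhd g v) x u = L.
    rewrite -[RHS]mulr1 -xv -xeig big_mkcond; apply: eq_bigr => y _.
    by rewrite inE; case: (g v y); rewrite ?mul1r ?mul0r.
  apply/eqP; rewrite -(eqr_nat R) natrM -[q.+1%:R]natr1 -LE dR -xS; apply/eqP.
  rewrite -sum1_card natr_sum -[#|_|]sum1_card natr_sum -sumrB mulr_suml xS.
  rewrite big_mkcond [RHS]big_mkcond /=; apply: eq_bigr => u _.
  case: (boolP (u \in nbhd g v)) => [|uS].
    rewrite inE => gvu; have [alt' _] := alt u gvu; case: alt'.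
      by move=> [_ e]; rewrite inP e ltxx subrr mul0r.
    by move=> [_ x1 e]; rewrite inP x1 mulrC e.
  by case: (boolP (u \in P)) => // /P_nb gvu; rewrite inE gvu in uS.
have cls u y : ~~ g u y -> coclass g y = coclass g u.
  case: (boolP (u \in P)) => [uP guy|/negbTE/notP]; last exact: cls_max.
  have sameP a b : ~~ g a b -> (b \in P) = (a \in P).
    move=> gab; case: (boolP (a \in P)) => [aP|/negbTE/notP xa].
      by rewrite inP (x_const a b) // -inP.
    rewrite inP; have [c gac] := has_nb a xa; have [_ _ far _] := loc a xa.
    by have [_ ->] := far c b gac gab; rewrite ltxx.
  pose S := nbhd g u; have CuP : coclass g u \subset P.
    by apply/fintype.subsetP => b; rewrite inE => /sameP ->.
  (* As [P] contains [u], [j] is positive; [u] misses [q + 1] vertices, so [j - 1] takes the place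
     of [j] in the neighbourhood of [u]. *)
  have [i jE] : exists i, j = i.+1.
    move: cardP; case: (j) => [|i _]; last by exists i.
    by rewrite mul0n => /eqP; rewrite cards_eq0 => /eqP e; rewrite e inE in uP.
  have dE : deg g u = (r.-1 * q + i)%N.
    have := card_coclass_deg g u; rewrite card_cls uP => e.
    by apply: (@addnI (q + true)); rewrite e nE jE qr /=; ring.
  have [muE muge] := lambda_turan R (deg g u) s0.
  set mu := lambda R _ in muE muge; have mu0 : 0 <= mu by exact: spec_rad_ge0.
  have ir : (i <= r.-1)%N by rewrite -ltnS prednK // -ltnS -jE ltnS ltnW.
  have [muE' _] := turan_char_eq s0 dE ir muE muge mu0.
  have SP : #|S :&: P| = (i * q.+1)%N.
    apply: (@addnI #|coclass g u|); rewrite card_cls uP addn1 -mulSn -jE -cardP.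
    rewrite -[RHS](cardsID S) addnC finset.setIC; congr (_ + _)%N.
    rewrite -[q.+1]addn1 -[X in (q + X)%N]/(nat_of_bool true) -uP -card_cls.
    apply: eq_card => b; rewrite !inE; case: (boolP (g u b)) => //= gub.
    by rewrite -inP (sameP u) // uP.
  (* A vertex [a] of [S] has all its [q] or [q + 1] non-neighbours in the whole graph; its excess
     inside [S] counts those outside [S], that is, in the coclass of [u]. *)
  have t0 := @no_excess_edges R _ g S P
    (fun a => #|coclass g a :&: coclass g u|) q mu mu0 q_gt0.
  have {}t0 a : a \in S -> #|coclass g a :&: coclass g u| = 0%N.
    apply: t0 => [b c _ _|b bS||z]; first exact: sameP.
    - rewrite nonnbE -card_cls -[RHS](cardsID S) finset.setIC; congr (_ + _)%N.
      by apply: eq_card => c; rewrite !inE andbC.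
    - rewrite SP -[#|S|]/(deg g u) natrM -[q.+1%:R]natr1 -muE'; ring.
    - apply: le_trans (lambda_ind_rayleigh S z g_sym) _.
      by rewrite ler_wpM2r ?ind //; apply: sumr_ge0 => b _; exact: sqr_ge0.
  (* A non-neighbour [b] of [y] adjacent to [u] would put [y] in the coclasses of both [b] and [u],
     against [t0]. *)
  apply/eqP; rewrite eqEcard !card_cls (sameP u y guy) leqnn andbT.
  apply/fintype.subsetP => b; rewrite !inE => gyb.
  apply/negP => gub; have := t0 b; rewrite inE => /(_ gub) /eqP.
  rewrite cards_eq0 => /eqP/setP/(_ y); rewrite !inE g_sym gyb.
  by rewrite guy.
exact: isomorphic_turan g_irr cls card_cls cardP nE jr q_gt0.
Qed.

(** * Fewer vertices than parts, and the general statement *)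

(** For [n < r] the Turan graph is complete. The difference [n - 1 - lam] is the sum over [y != v]
    of the nonnegative numbers [1 - (g v y)%:R * x y]. *)
Lemma lambda_complete_bound (R : realType) (n : nat) (g : rel 'I_n)
    (x : 'I_n -> R) (v : 'I_n) (lam : R) : irreflexive g ->
  (forall u, 0 <= x u) -> (forall u, x u <= 1) -> x v = 1 ->
  (forall u, \sum_y (g u y)%:R * x y = lam * x u) ->
  lam <= n%:R - 1 /\
  (lam = n%:R - 1 -> forall y, y != v -> g v y /\ x y = 1).
Proof.
move=> g_irr x_ge0 x_le1 xv xeig.
have lamE : lam = \sum_(y in [set~ v]) (g v y)%:R * x y.
  transitivity (lam * x v); first by rewrite xv mulr1.
  rewrite -xeig (bigD1 v) //= g_irr mul0r add0r.
  by apply: eq_bigl => y; rewrite !inE.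
have nE : n%:R - 1 = \sum_(y in [set~ v]) 1 :> R.
  have n0 : (0 < n)%N := leq_ltn_trans (leq0n v) (ltn_ord v).
  by rewrite sumr_const cardsC1 card_ord -subn1 natrB.
have gap : n%:R - 1 - lam = \sum_(y in [set~ v]) (1 - (g v y)%:R * x y).
  by rewrite nE lamE -sumrB.
have term_ge0 y : 0 <= 1 - (g v y)%:R * x y.
  by case: (g v y); rewrite ?mul1r ?mul0r ?subr_ge0 ?subr0.
split; first by rewrite -subr_ge0 gap; apply: sumr_ge0.
move=> e y yv; have := sum_ge0_eq0 (S := [set~ v]) (fun y _ => term_ge0 y) _ (u := y).
rewrite -gap e subrr !inE => /(_ (lexx 0) yv).
by case: (g v y); rewrite ?mul1r ?mul0r; [split=> //; lra | lra].
Qed.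

Theorem theorem1p4 (R : realType) (r n : nat) (g : rel 'I_n) :
  (2 <= r)%N -> simple_graph g ->
  lambda R (turan r n) <= lambda R g ->
  (isomorphic g (turan r n) \/
   exists v : 'I_n,
     lambda R (turan (r.-1) (deg g v)) < lambda_ind R g (nbhd g v)) /\
  (lambda R (turan r n) < lambda R g ->
   forall (x : 'cV[R]_n),
     x != 0 -> (forall i, 0 <= x i ord0) ->
     adj R g *m x = lambda R g *: x ->
     forall v : 'I_n, (forall u, x u ord0 <= x v ord0) ->
       lambda R (turan (r.-1) (deg g v)) < lambda_ind R g (nbhd g v)).
Proof.
move=> r2 [g_sym g_irr] Lle; have r0 : (0 < r)%N by exact: ltnW.
have normalise (x : 'cV[R]_n) (v : 'I_n) : x != 0 -> (forall i, 0 <= x i ord0) ->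
    adj R g *m x = lambda R g *: x -> (forall u, x u ord0 <= x v ord0) ->
    exists y : 'I_n -> R, [/\ forall u, 0 <= y u, forall u, y u <= 1, y v = 1 &
      forall u, \sum_w (g u w)%:R * y w = lambda R g * y u].
  move=> x0 x_ge0 xeig xmax.
  have xv : 0 < x v ord0.
    rewrite lt0r x_ge0 andbT; apply: contra x0 => /eqP e.
    apply/eqP/matrixP => i k; rewrite mxE ord1; apply/le_anti.
    by rewrite x_ge0 andbT -e xmax.
  exists (fun u => x u ord0 / x v ord0); split=> [u|u||u].
  - by rewrite divr_ge0 // ltW.
  - by rewrite ler_pdivrMr // mul1r.
  - by rewrite divff // gt_eqF.
  have := congr1 (fun A : 'cV[R]_n => A u ord0) xeig; rewrite !mxE mulrA => <-.
  by rewrite mulr_suml; apply: eq_bigr => w _; rewrite !mxE mulrA.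
have [nr|rn] := ltnP n r.
  have small (x : 'cV[R]_n) (v : 'I_n) : x != 0 -> (forall i, 0 <= x i ord0) ->
      adj R g *m x = lambda R g *: x -> (forall u, x u ord0 <= x v ord0) ->
      lambda R g = lambda R (turan r n) /\ isomorphic g (turan r n).
    move=> x0 x_ge0 xeig xmax.
    have [y [y_ge0 y_le1 yv yeig]] := normalise x v x0 x_ge0 xeig xmax.
    have [_] := lambda_turan R n r0.
    rewrite divn_small // subr0 => Lge.
    have [lam_le full] := lambda_complete_bound g_irr y_ge0 y_le1 yv yeig.
    have lamE : lambda R g = n%:R - 1 by lra.
    split; first by lra.
    exists 1%g => a b; rewrite !perm1 /turan.
    rewrite !modn_small ?(ltn_trans (ltn_ord _) nr) //.
    have [->|ba] := eqVneq b a; first by rewrite g_irr eqxx.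
    (* Equality at [v] gives every vertex weight [1], so the same lemma can be applied again with
       [a] as the maximal vertex. *)
    have ya : y a = 1.
      by have [->//|av] := eqVneq a v; have [] := full lamE a av.
    have [_ full'] := lambda_complete_bound g_irr y_ge0 y_le1 ya yeig.
    by have [-> _] := full' lamE b ba; rewrite eq_sym (inj_eq val_inj) ba.
  split=> [|lt x x0 x_ge0 xeig v xmax]; last first.
    have [e _] := small x v x0 x_ge0 xeig xmax.
    by rewrite e ltxx in lt.
  left; have [n0|n0] := posnP n.
    by exists 1%g => a; have := ltn_ord a; rewrite {2}n0.
  have [x [x0 x_ge0 xeig]] := lambda_perron R n0 g_sym.
  have := @arg_maxP _ _ _ (Ordinal n0) xpredT (fun u => x u ord0) isT.
  case=> v _ xmax; have [] // := small x v x0 x_ge0 xeig.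
  by move=> u; exact: xmax.
have strict : lambda R (turan r n) < lambda R g -> forall (x : 'cV[R]_n),
     x != 0 -> (forall i, 0 <= x i ord0) ->
     adj R g *m x = lambda R g *: x ->
     forall v : 'I_n, (forall u, x u ord0 <= x v ord0) ->
       lambda R (turan (r.-1) (deg g v)) < lambda_ind R g (nbhd g v).
  move=> lt x x0 x_ge0 xeig v xmax; rewrite ltNge; apply/negP => ind.
  have [y [y_ge0 y_le1 yv yeig]] := normalise x v x0 x_ge0 xeig xmax.
  have [e _ _ _] := max_vertex_gap r2 rn g_sym g_irr y_ge0 y_le1 yv yeig Lle ind.
  by rewrite e ltxx in lt.
split; last exact: strict.
have n0 : (0 < n)%N by exact: leq_trans rn.
have [x [x0 x_ge0 xeig]] := lambda_perron R n0 g_sym.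
have := @arg_maxP _ _ _ (Ordinal n0) xpredT (fun u => x u ord0) isT.
case=> v _ xmax'; have xmax u : x u ord0 <= x v ord0 by exact: xmax'.
have [/existsP h|] := boolP [exists v : 'I_n,
  lambda R (turan (r.-1) (deg g v)) < lambda_ind R g (nbhd g v)].
  by right.
rewrite negb_exists => /forallP ind; left.
have {}ind u : lambda_ind R g (nbhd g u) <= lambda R (turan r.-1 (deg g u)).
  by rewrite leNgt ind.
have [y [y_ge0 y_le1 yv yeig]] := normalise x v x0 x_ge0 xeig xmax.
apply: (equality_case r2 rn g_sym g_irr y_ge0 y_le1 yv _ ind) => u.
(* A strictly larger spectral radius is excluded by [strict] at [v], so the eigenvalue is that of
   the Turan graph. *)
rewrite yeig; congr (_ * _); apply/le_anti; rewrite Lle andbT leNgt.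
by apply/negP => lt; have := strict lt x x0 x_ge0 xeig v xmax; rewrite ltNge ind.
Qed.
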